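(* Let $\alpha\in\mathbb{N}_0$, let $\mathcal{B}$ be a finite basis of the complex vector space $\mathcal{P}^{m,n}_\alpha$, and let $A\in\mathbb{Z}^{m\times m}$ be a positive definite symmetric matrix. Every solution $f:\mathbb{R}^{m\times n}\to\mathbb{C}$ of the $n\times n$ system of partial differential equations $$\Bigl(\mathbf{E}-\frac{\mathbf{\Delta}_A}{4\pi}\Bigr)f=\alpha\cdot I\cdot f$$ that additionally satisfies the growth condition that $f(U)\exp(-\pi\operatorname{tr}(U^{T}AU))$ is a Schwartz function on $\mathbb{R}^{m\times n}$ is a polynomial. Moreover, a finite basis of the complex vector space of these solutions is given by the functions $$p=\exp\bigl(-\operatorname{tr}\mathbf{\Delta}_A/8\pi\bigr)P\qquad\text{with } P\in\mathcal{B}.$$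
   Context: $1/8\pi$ means $1/(8\pi)$. $\mathcal{P}^{m,n}_\alpha$ is the complex vector space of polynomials $P:\mathbb{C}^{m\times n}\to\mathbb{C}$ with $P(UN)=(\det N)^\alpha P(U)$ for all $N\in\mathbb{C}^{n\times n}$ (it is finite-dimensional); its elements are restricted to $\mathbb{R}^{m\times n}$. For $U\in\mathbb{R}^{m\times n}$, $\mathbf{E}$ and $\mathbf{\Delta}_A$ are the $n\times n$ matrices of differential operators with entries $\mathbf{E}_{ij}=\sum_{d=1}^m U_{di}\frac{\partial}{\partial U_{dj}}$ and $(\mathbf{\Delta}_A)_{ij}=\sum_{a,b=1}^m\frac{\partial}{\partial U_{ai}}(A^{-1})_{ab}\frac{\partial}{\partial U_{bj}}$; $\operatorname{tr}\mathbf{\Delta}_A$ is the sum of the diagonal entries, and $\exp(c\operatorname{tr}\mathbf{\Delta}_A)P=\sum_{k\ge0}\frac{c^k}{k!}(\operatorname{tr}\mathbf{\Delta}_A)^kP$ (a finite sum). $I$ is the $n\times n$ identity matrix. *)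

(* Defs.v *)
From HB Require Import structures.
From mathcomp Require Import all_boot all_order all_algebra.
From mathcomp Require Import complex.
From mathcomp Require mpoly.
From mathcomp Require Import all_classical all_reals all_analysis.

Set Implicit Arguments.
Unset Strict Implicit.
Unset Printing Implicit Defensive.

Import Order.TTheory GRing.Theory Num.Theory.
Import numFieldNormedType.Exports.

Local Open Scope classical_set_scope.
Local Open Scope ring_scope.
Local Open Scope complex_scope.

Section Bases.
Variables (K : fieldType) (V : lmodType K).

(* [V] may be infinite-dimensional, so the subspace [S] is a mere set and
   {vspace V} is not available. *)
Definition lin_indep (r : nat) (b : 'I_r -> V) : Prop :=
  forall c : 'I_r -> K, \sum_(i < r) c i *: b i = 0 -> forall i, c i = 0.

Definition is_basis (S : set V) (r : nat) (b : 'I_r -> V) : Prop :=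
  lin_indep b /\
  [set v | exists c : 'I_r -> K, v = \sum_(i < r) c i *: b i] = S.

End Bases.

Section Polynomials.
Variables (R : realType) (m n : nat).

Definition poly_fun (P : 'M[R[i]]_(m, n) -> R[i]) : Prop :=
  exists p : mpoly.mpoly (m * n) R[i],
    forall U, P U = mpoly.meval (fun k => mxvec U 0 k) p.

Definition restr_real (P : 'M[R[i]]_(m, n) -> R[i]) : 'M[R]_(m, n) -> R[i] :=
  fun U => P (map_mx (real_complex R) U).

Definition real_poly_fun (f : 'M[R]_(m, n) -> R[i]) : Prop :=
  exists2 P, poly_fun P & f = restr_real P.

Definition det_poly (alpha : nat) : set ('M[R[i]]_(m, n) -> R[i]) :=
  [set P | poly_fun P /\
    forall (N : 'M[R[i]]_n) (U : 'M[R[i]]_(m, n)),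
      P (U *m N) = \det N ^+ alpha * P U].

End Polynomials.

Section DifferentialOperators.
Variables (R : realType) (m n : nat).
Implicit Types (f g : 'M[R]_(m, n) -> R[i]) (U : 'M[R]_(m, n)).

Definition ReF f : 'M[R]_(m, n) -> R := fun U => complex.Re (f U).
Definition ImF f : 'M[R]_(m, n) -> R := fun U => complex.Im (f U).

(* R[i] is not equipped with a normed module structure over R, so real partial
   derivatives of complex-valued functions are taken componentwise. *)
Definition pderivable (i : 'I_m) (j : 'I_n) f : Prop :=
  forall U, derivable (ReF f) U (delta_mx i j) /\
            derivable (ImF f) U (delta_mx i j).

Definition pderiv (i : 'I_m) (j : 'I_n) f : 'M[R]_(m, n) -> R[i] :=
  fun U => 'D_(delta_mx i j) (ReF f) U +i* 'D_(delta_mx i j) (ImF f) U.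

Definition iter_pderiv (s : seq ('I_m * 'I_n)) f : 'M[R]_(m, n) -> R[i] :=
  foldr (fun ij => pderiv ij.1 ij.2) f s.

(* C^oo: all iterated partial derivatives exist and are continuous. *)
Definition smooth f : Prop :=
  forall s : seq ('I_m * 'I_n),
    [/\ continuous (ReF (iter_pderiv s f)),
        continuous (ImF (iter_pderiv s f))
      & forall i j, pderivable i j (iter_pderiv s f)].

(* [b] is the multi-index of a monomial in the entries of U; derivatives range
   over all words [s] of coordinates instead of multi-indices. *)
Definition schwartz f : Prop :=
  smooth f /\
  forall (b : 'M[nat]_(m, n)) (s : seq ('I_m * 'I_n)),
    exists M : R, forall U,
      `|(\prod_i \prod_j U i j ^+ b i j)%:C * iter_pderiv s f U| <= M%:C.

Definition euler f U : 'M[R[i]]_n :=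
  \matrix_(i, j) \sum_(d < m) (U d i)%:C * pderiv d j f U.

Variable A : 'M[int]_m.

Definition real_mx : 'M[R]_m := map_mx intr A.

Definition laplace f U : 'M[R[i]]_n :=
  \matrix_(i, j) \sum_(a < m) \sum_(b < m)
     (invmx real_mx a b)%:C * pderiv a i (pderiv b j f) U.

Definition tr_laplace f : 'M[R]_(m, n) -> R[i] := fun U => \tr (laplace f U).

(* The topology on R[i] comes from its regular module R[i]^o. On polynomial
   functions the terms of the series are eventually zero. *)
Definition exp_tr_laplace (c : R) f : 'M[R]_(m, n) -> R[i] := fun U =>
  limn (series (fun k =>
    (c ^+ k / k`!%:R)%:C * iter k tr_laplace f U) : nat -> R[i]^o).

Definition symmetric_posdef : Prop :=
  A^T = A /\
  forall x : 'cV[R]_m, x != 0 -> 0 < (x^T *m real_mx *m x) 0 0.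

Definition gauss U : R := expR (- pi * \tr (U^T *m real_mx *m U)).

Definition pde_solution (alpha : nat) f : Prop :=
  forall U, euler f U - ((4 * pi)^-1)%:C *: laplace f U =
            (alpha%:R * f U) *: 1%:M.

Definition growth_solution (alpha : nat) : set ('M[R]_(m, n) -> R[i]) :=
  [set f | pde_solution alpha f /\ schwartz (fun U => f U * (gauss U)%:C)].

End DifferentialOperators.

(* Main.v *)
(** All operators have real coefficients, so real and imaginary parts are
    treated separately.

    If f solves the system, its trace reads (tr E - tr Delta_A / 4pi) f = k f
    with k = n alpha, and since [d, tr E] = d every partial derivative of order
    s solves the same equation with k - s in place of k, with the same growth.
    For such a solution h, the function g = h exp(-pi tr U^T A U) satisfies
    tr Delta_A g = (4 pi^2 tr U^T A U - 4 pi (k - s) - 2 pi m n) g and vanishes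
    at infinity.  Once s is large the factor is positive, and the maximum
    principle (tr Delta_A g <= 0 at a maximum of g) forces g = 0.  So all
    derivatives of f of some order vanish and f is a polynomial.

    On polynomials exp(c tr Delta_A) is invertible and the commutation relation
    [tr Delta_A, E_ij] = 2 (Delta_A)_ij turns E - Delta_A / 4pi into E for
    c = -1/8pi.  Finally E P = alpha I P characterizes the real points of the
    polynomials with P (U N) = det(N)^alpha P(U): along the line
    N(t) = 1 + t (N - 1), both P (U N(t)) and det(N(t))^alpha have logarithmic
    derivative alpha tr(N(t)^-1 (N - 1)), and polynomial identities extend from
    real to complex matrices. *)

From HB Require Import structures.
Require Import Defs.
From mathcomp Require Import all_boot all_order all_algebra.
From mathcomp Require Import complex.
From mathcomp Require mpoly.
From mathcomp Require Import all_classical all_reals all_analysis.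
From mathcomp Require Import ring lra.

Set Implicit Arguments.
Unset Strict Implicit.
Unset Printing Implicit Defensive.

Import Order.TTheory GRing.Theory Num.Theory.
Import numFieldNormedType.Exports.

Local Open Scope classical_set_scope.
Local Open Scope ring_scope.

(** * Directional derivatives *)

(** Derivatives are given only as directional limits, so the calculus is built on continuous partial
    derivatives and the mean value theorem along lines. Smoothness and decay are assumed only for f
    times the Gaussian g. Smoothness of f is recovered by multiplying with the inverse Gaussian, and
    (df) g = d(f g) + 2 pi (A U) f g hands the decay on to the derivatives of f. The Gaussian
    exp(-pi tr U^T A U) is the weight for which conjugating tr Delta_A produces -4 pi tr E; with it
    the equation cancels all derivatives and leaves multiplication by a function. With the trace
    eigenvalue n alpha, that function is positive as soon as 2 (n alpha - s) < - m n. On the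
    algebraic side exponentials are handled as truncated sums, since some power of tr Delta_A kills
    any given polynomial. The logarithmic derivatives are cleared of denominators with the adjugate,
    since N(t) may be singular. *)

Section DirectionalDerivatives.
Variables (R : realType) (V : normedModType R).
Implicit Types (f g : V -> R) (x y v w : V).

Lemma is_derive_derivable f x v df : is_derive x v f df -> derivable f x v.
Proof. by case. Qed.

Lemma is_derive_val f x v df : is_derive x v f df -> 'D_v f x = df.
Proof. by case. Qed.

Lemma is_derive_line f x v (t df : R) :
  is_derive (x + t *: v) v f df -> is_derive t 1 (fun s : R => f (x + s *: v)) df.
Proof.
have E : (fun h : R => h^-1 *: ((f \o shift (x + t *: v)) (h *: v) -
      f (x + t *: v))) =
    (fun h : R => h^-1 *: (((fun s : R => f (x + s *: v)) \o shift t) (h *: 1) -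
      (fun s : R => f (x + s *: v)) t)).
  apply/funext => h /=; congr (_ *: (f _ - _)).
  by rewrite addrCA [_%:A]mulr1 scalerDl addrA.
by case=> dfx <-; split; rewrite /derivable /derive -E.
Qed.

(** Only one directional derivative of [f] is assumed, not differentiability, so the chain rule is
    reduced to the one-variable rule along the line [x + s *: v]. *)
Lemma is_derive_compR (phi : R -> R) f x v (a df : R) :
  is_derive (f x) (1 : R) phi a -> is_derive x v f df ->
  is_derive x v (phi \o f) (a * df).
Proof.
move=> dphi df0; pose g (s : R) := f (x + s *: v).
have g0 : g 0 = f x by rewrite /g scale0r addr0.
have dg : is_derive (0 : R) (1 : R) g df.
  by apply: is_derive_line; rewrite scale0r addr0.
have : is_derive (0 : R) (1 : R) (phi \o g) (a * df).
  by apply: is_derive1_comp; rewrite ?g0.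
have E : (fun h : R => h^-1 *: (((phi \o f) \o shift x) (h *: v) -
      (phi \o f) x)) =
    (fun h : R => h^-1 *: (((phi \o g) \o shift 0) (h *: 1) - (phi \o g) 0)).
  apply/funext => h /=; rewrite g0 /g addr0 [_%:A]mulr1.
  by rewrite [x + _]addrC.
by case=> d <-; split; rewrite /derivable /derive E.
Qed.

(** The sign of [h] is free, since difference quotients approach 0 from both sides; the intermediate
    point is therefore located only by its absolute value. *)
Lemma mvt_line f x v (h : R) : (forall y, derivable f y v) ->
  exists2 c : R, `|c| <= `|h| & f (x + h *: v) - f x = h * 'D_v f (x + c *: v).
Proof.
move=> df; pose phi (s : R) := f (x + s *: v).
have dphi (s : R) : is_derive s 1 phi ('D_v f (x + s *: v)).
  exact/is_derive_line/derivableP.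
have cphi : continuous phi.
  by move=> s; apply/differentiable_continuous/derivable1_diffP; case: (dphi s).
have -> : f x = phi 0 by rewrite /phi scale0r addr0.
rewrite -/(phi h).
have [h0|h0] := leP 0 h.
  have [c] := MVT_segment h0 (fun s _ => dphi s) (continuous_subspaceT cphi).
  rewrite in_itv /= subr0 => /andP[c0 ch] E; exists c; last by rewrite E mulrC.
  by rewrite !ger0_norm.
have [c] := MVT_segment (ltW h0) (fun s _ => dphi s) (continuous_subspaceT cphi).
rewrite in_itv /= sub0r => /andP[ch c0] E.
exists c; first by rewrite !ler0_norm ?lerN2// ltW.
by rewrite -opprB E mulrN opprK mulrC.
Qed.

(** The increment along [v + w] is a step along [v] followed by one along [w]. The second step does
    not start at [x]; the mean value theorem and the continuity of ['D_w f] at [x] control it. *)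
Lemma is_deriveD_dir f x v w : (forall y, derivable f y w) ->
  {for x, continuous ('D_w f)} -> derivable f x v ->
  is_derive x (v + w) f ('D_v f x + 'D_w f x).
Proof.
move=> dw cw dv.
suff H : (fun h : R => h^-1 *: ((f \o shift x) (h *: (v + w)) - f x)) @ 0^'
    --> 'D_v f x + 'D_w f x.
  by split; [apply/cvg_ex; exists ('D_v f x + 'D_w f x)|exact: (cvg_lim _ H)].
pose q1 (h : R) := h^-1 *: ((f \o shift x) (h *: v) - f x).
pose q2 (h : R) := h^-1 * (f (x + h *: v + h *: w) - f (x + h *: v)).
have -> : (fun h : R => h^-1 *: ((f \o shift x) (h *: (v + w)) - f x)) = q1 \+ q2.
  apply/funext => h; rewrite /q1 /q2 /= [h *: (v + w)]scalerDr.
  rewrite [h *: v + h *: w + x]addrC addrA.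
  rewrite [h *: v + x]addrC -![_ *: (f _ - _)]/(_ * _); ring.
apply: cvgD; first exact: dv.
apply/cvgrPdist_lt => e e0.
move/cvgrPdist_lt : cw => /(_ _ e0) /nbhs_ballP[d /= d0 dP].
(* The summand 1 keeps [K] positive even when both directions vanish. *)
pose K := `|v| + `|w| + 1.
have K0 : 0 < K by rewrite ltr_wpDl ?addr_ge0.
near=> h.
have h0 : h != 0 by near: h; exact: nbhs_dnbhs_neq.
have hd : `|h| < d / K by near: h; apply: dnbhs0_lt; rewrite divr_gt0.
have [c ch E] := mvt_line (x + h *: v) h dw.
rewrite /q2 E mulKf//; apply: dP => /=.
rewrite -ball_normE /= -addrA opprD addNKr normrN.
rewrite (le_lt_trans (ler_normD _ _))// !normrZ.
rewrite (@le_lt_trans _ _ (`|h| * K))// -?ltr_pdivlMr// /K !mulrDr mulr1.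
by rewrite ler_wpDr// lerD2l ler_wpM2r.
Unshelve. all: by end_near. Qed.

Lemma is_deriveZ_dir f x v (c : R) : derivable f x v ->
  is_derive x (c *: v) f (c * 'D_v f x).
Proof.
(* For [c = 0] the substitution of [h * c] for [h] would leave the punctured neighbourhood. *)
move=> df; have [->|c0] := eqVneq c 0.
  by rewrite scale0r mul0r; exact: is_derive0.
have H : (fun h : R => h^-1 *: ((f \o shift x) (h *: (c *: v)) - f x)) @ 0^'
    --> c * 'D_v f x.
  have -> : (fun h : R => h^-1 *: ((f \o shift x) (h *: (c *: v)) - f x)) =
     (fun h => c * ((fun h => h^-1 *: ((f \o shift x) (h *: v) - f x))
                     \o (fun h : R => h * c)) h).
    apply/funext => h /=; rewrite scalerA -![_ *: (f _ - _)]/(_ * _).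
    by rewrite invfM mulrA [c * (_ * _)]mulrA [c * h^-1]mulrC mulfK.
  apply: cvgMr; apply: cvg_comp df => A.
  rewrite /= /nbhs /= => -[e /= e0 eA].
  exists (e / `|c|) => /=; first by rewrite divr_gt0 ?normr_gt0.
  move=> h; rewrite /ball_ /= sub0r normrN ltr_pdivlMr ?normr_gt0// => he h0.
  by apply: eA; rewrite /ball_ /= ?sub0r ?normrN ?normrM ?mulf_neq0.
by split; [apply/cvg_ex; exists (c * 'D_v f x)|exact: (cvg_lim _ H)].
Qed.

Lemma is_derive_sum_dir f x (I : Type) (s : seq I) (e : I -> V) (c : I -> R) :
  (forall i y, derivable f y (e i)) ->
  (forall i, continuous ('D_(e i) f)) ->
  is_derive x (\sum_(i <- s) c i *: e i) f (\sum_(i <- s) c i * 'D_(e i) f x).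
Proof.
move=> df cf; elim: s => [|i s IH]; first by rewrite !big_nil; exact: is_derive0.
rewrite !big_cons [X in is_derive _ X]addrC [X in is_derive _ _ _ X]addrC.
have dZ y := is_deriveZ_dir (c i) (df i y).
have E : 'D_(c i *: e i) f = (fun y => c i * 'D_(e i) f y).
  by apply/funext => y; rewrite (is_derive_val (dZ y)).
have := @is_deriveD_dir f x (\sum_(i <- s) c i *: e i) (c i *: e i) _ _
  (is_derive_derivable IH).
rewrite (is_derive_val IH) E (is_derive_val (dZ x)); apply.
  by move=> y; exact: is_derive_derivable (dZ y).
by apply: cvgMr; exact: cf.
Qed.

(** Mean value theorem twice: along [u] for the increment of [g] by [h *: z], then along [z] for
    ['D_u g]. The left side is symmetric in [u] and [z], whence the equality of mixed derivatives;
    the case [u = z] gives the second derivative test. *)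
Lemma second_difference g u z (h : R) x : h != 0 ->
    (forall y, derivable g y u) -> (forall y, derivable g y z) ->
    (forall y, derivable ('D_u g) y z) ->
  exists2 y, `|x - y| <= `|h| * (`|u| + `|z|) &
    g (x + h *: u + h *: z) - g (x + h *: u) - (g (x + h *: z) - g x) =
    h ^+ 2 * 'D_z ('D_u g) y.
Proof.
move=> h0 gu gz guz.
pose phi y := g (y + h *: z) - g y.
have dphi y : is_derive y u phi ('D_u g (y + h *: z) - 'D_u g y).
  apply: is_deriveB; last exact: derivableP.
  have := derivableP (gu (y + h *: z)).
  have E : (fun k : R => k^-1 *: ((g \o shift (y + h *: z)) (k *: u) -
        g (y + h *: z))) =
      (fun k : R => k^-1 *: (((fun y => g (y + h *: z)) \o shift y) (k *: u) -
        g (y + h *: z))).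
    by apply/funext => k /=; rewrite addrA.
  by case=> d _; split; rewrite /derivable /derive -E.
have [c ch E] := @mvt_line phi x u h (fun y => is_derive_derivable (dphi y)).
have [c' ch' E'] := mvt_line (x + c *: u) h guz.
exists (x + c *: u + c' *: z).
  rewrite -addrA opprD addNKr normrN (le_trans (ler_normD _ _))// !normrZ.
  by rewrite mulrDr lerD// ler_wpM2r.
rewrite -/(phi (x + h *: u)) -/(phi x) E (is_derive_val (dphi _)) E'.
by rewrite mulrA.
Qed.

Lemma schwarz f v w :
  (forall y, derivable f y v) -> (forall y, derivable f y w) ->
  (forall y, derivable ('D_v f) y w) -> (forall y, derivable ('D_w f) y v) ->
  continuous ('D_w ('D_v f)) -> continuous ('D_v ('D_w f)) ->
  'D_w ('D_v f) = 'D_v ('D_w f).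
Proof.
(* Both mixed derivatives, at points near [x], are the same second difference
   quotient. *)
have close (e a b c : R) : `|a - b| < e / 2 -> `|c - b| < e / 2 -> `|a - c| <= e.
  rewrite [`|c - _|]distrC => ab bc; rewrite (le_trans (ler_distD b _ _))//.
  by rewrite [e]splitr lerD// ltW.
move=> fv fw fvw fwv cvw cwv; apply/funext => x.
apply/eqP; rewrite -subr_eq0 -normr_le0; apply/ler_addgt0Pl => e e0; rewrite addr0.
have e20 : 0 < e / 2 by rewrite divr_gt0.
move/cvgrPdist_lt : (cvw x) => /(_ _ e20) /nbhs_ballP[d /= d0 dP].
move/cvgrPdist_lt : (cwv x) => /(_ _ e20) /nbhs_ballP[d' /= d'0 dP'].
pose K := `|v| + `|w| + 1.
have K0 : 0 < K by rewrite ltr_wpDl ?addr_ge0.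
pose D := Num.min d d'.
have D0 : 0 < D by rewrite lt_min d0.
pose h := D / 2 / K.
have h0 : 0 < h by rewrite !divr_gt0.
have hK : `|h| * (`|v| + `|w|) < D.
  rewrite gtr0_norm// (@le_lt_trans _ _ (h * K)) ?ler_wpM2l ?lerDl ?ltW//.
  by rewrite /h divfK ?gt_eqF// gtr_pMr// invf_lt1// ltr1n.
have hN : h != 0 by rewrite gt_eqF.
have [y1 yx1 E1] := second_difference x hN fv fw fvw.
have [y2 yx2 E2] := second_difference x hN fw fv fwv.
have /dP dy1 : ball x d y1.
  by rewrite -ball_normE /= (le_lt_trans yx1)// (lt_le_trans hK)// ge_min lexx.
have /dP' dy2 : ball x d' y2.
  rewrite -ball_normE /= (le_lt_trans yx2)// addrC (lt_le_trans hK)//.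
  by rewrite ge_min lexx orbT.
have E : 'D_w ('D_v f) y1 = 'D_v ('D_w f) y2.
  apply: (mulfI (expf_neq0 2 hN)).
  apply: etrans (esym E1) _; apply: etrans E2.
  by rewrite [x + h *: w + h *: v]addrAC; ring.
rewrite E in dy1; exact: close dy1 dy2.
Qed.

(** At a maximum f(x + hv) - 2 f(x) + f(x - hv) is nonpositive. It is also a positive multiple of
    the second derivative at a nearby point, which by continuity would be positive if the one at [x]
    were. *)
Lemma second_derive_at_max f v x :
  (forall y, derivable f y v) -> (forall y, derivable ('D_v f) y v) ->
  continuous ('D_v ('D_v f)) -> (forall y, f y <= f x) -> 'D_v ('D_v f) x <= 0.
Proof.
have key (a b c : R) : b <= a -> c <= a -> c - a - (a - b) <= 0 by lra.
move=> fv fvv cvv fmax; rewrite leNgt; apply/negP => pos.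
have /nbhs_ballP[d /= d0 dP] : \forall y \near x, 0 < 'D_v ('D_v f) y.
  by apply: (cvgr_gt _ (cvv x)).
(* One norm accounts for the base point [x - h *: v], two for the distance allowed by
   [second_difference]. *)
pose K := `|v| + `|v| + `|v| + 1.
have K0 : 0 < K by rewrite ltr_wpDl ?addr_ge0.
pose h := d / 2 / K.
have h0 : 0 < h by rewrite !divr_gt0.
have hN : h != 0 by rewrite gt_eqF.
have [y xy E] := second_difference (x - h *: v) hN fv fv fvv.
have : 0 < 'D_v ('D_v f) y.
  apply: dP; rewrite -ball_normE /= -(subrKA (x - h *: v)).
  rewrite (le_lt_trans (ler_normD _ _))//.
  rewrite (_ : x - (x - h *: v) = h *: v); last by rewrite opprB addrC subrK.
  rewrite normrZ.
  rewrite (@le_lt_trans _ _ (h * K))//; last first.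
    by rewrite /h divfK ?gt_eqF// gtr_pMr// invf_lt1// ltr1n.
  rewrite (le_trans (lerD (lexx _) xy))// gtr0_norm// -mulrDr ler_wpM2l ?ltW//.
  by rewrite /K addrA ltrDl.
rewrite ltNge => /negP; apply; rewrite -(pmulr_rle0 _ (exprn_gt0 2 h0)) -E.
by rewrite (subrK (h *: v) x); exact: key.
Qed.

End DirectionalDerivatives.

(** * Smooth real functions of a matrix *)

Section SmoothFunctions.
Variables (R : realType) (m n : nat).
Local Notation X := 'M[R]_(m, n).
Local Notation idx := ('I_m * 'I_n)%type.
Implicit Types (u v w : X -> R) (k l : idx).

Definition dpar k u : X -> R := 'D_(delta_mx k.1 k.2) u.

(** Iterated partial derivatives, as in [smooth], instead of Frechet derivatives; recursion on the
    order lets the Leibniz rule be used by induction. *)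
Fixpoint Ck (d : nat) u : Prop :=
  if d is e.+1 then
    continuous u /\
    forall k, (forall x, derivable u x (delta_mx k.1 k.2)) /\ Ck e (dpar k u)
  else continuous u.

Definition Cinf u := forall d, Ck d u.

Definition crd (i : 'I_m) (j : 'I_n) : X -> R := fun U => U i j.

Lemma CkS d u : Ck d.+1 u -> Ck d u.
Proof.
elim: d u => [|d IH] u; first by case.
by move=> [cu du]; split=> // k; have [duk /IH] := du k.
Qed.

Lemma Cinf_continuous u : Cinf u -> continuous u.
Proof. by move=> /(_ 0). Qed.

Lemma Cinf_derivable u k x : Cinf u -> derivable u x (delta_mx k.1 k.2).
Proof. by move=> /(_ 1) [_ /(_ k)[]]. Qed.

Lemma Cinf_dpar u k : Cinf u -> Cinf (dpar k u).
Proof. by move=> su d; have [_ /(_ k)[]] := su d.+1. Qed.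

Lemma dpar_cst k (c : R) : dpar k (cst c) = 0.
Proof. by apply/funext => x; rewrite /dpar derive_cst. Qed.

Lemma Cinf_cst (c : R) : Cinf (cst c).
Proof.
move=> d; elim: d c => [|d IH] c; first exact: cst_continuous.
split; first exact: cst_continuous.
by move=> k; rewrite dpar_cst; split=> [x|]; [exact: derivable_cst|exact: IH].
Qed.

Lemma is_derive_crd i j x (v : X) : is_derive x v (crd i j) (v i j).
Proof.
apply: DeriveDef; first exact: diff_derivable (differentiable_coord _ _ _).
apply: lim_near_cst => //; near=> h => /=.
rewrite /crd !mxE addrK -[_ *: _]/(_ * _) mulKf//.
by near: h; exact: nbhs_dnbhs_neq.
Unshelve. all: by end_near. Qed.

Lemma dpar_crd k i j : dpar k (crd i j) = cst ((k == (i, j))%:R).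
Proof.
apply/funext => x; rewrite /dpar (is_derive_val (is_derive_crd _ _ _ _)) mxE.
by case: k => a b /=; rewrite [i == a]eq_sym [j == b]eq_sym xpair_eqE.
Qed.

Lemma Cinf_crd i j : Cinf (crd i j).
Proof.
case=> [|d]; first exact: coord_continuous.
split; first exact: coord_continuous.
move=> k; split; last by rewrite dpar_crd; exact: Cinf_cst.
by move=> x; exact: is_derive_derivable (is_derive_crd i j x _).
Qed.

Lemma dparD k u v : Cinf u -> Cinf v -> dpar k (u + v) = dpar k u + dpar k v.
Proof.
by move=> su sv; apply/funext => x; rewrite /dpar deriveD//; exact: Cinf_derivable.
Qed.

Lemma dparZ k (c : R) u : Cinf u -> dpar k (c *: u) = c *: dpar k u.
Proof.
by move=> su; apply/funext => x; rewrite /dpar deriveZ//; exact: Cinf_derivable.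
Qed.

Lemma dparM k u v : Cinf u -> Cinf v ->
  dpar k (u * v) = dpar k u * v + u * dpar k v.
Proof.
move=> su sv; apply/funext => x.
rewrite /dpar deriveM; [|exact: Cinf_derivable..].
by rewrite addrC; congr (_ + _); rewrite -[LHS]/(_ * _) mulrC.
Qed.

Lemma Ck_add d u v : Ck d u -> Ck d v -> Ck d (u + v).
Proof.
elim: d u v => [|d IH] u v su sv.
  by move=> x; exact: (continuousD (su x) (sv x)).
case: su sv => cu du [cv dv].
split; first by move=> x; exact: (continuousD (cu x) (cv x)).
move=> k; have [dvk svk] := dv k; have [duk suk] := du k.
split; first by move=> x; exact: derivableD.
rewrite (_ : dpar k (u + v) = dpar k u + dpar k v); first exact: IH.
by apply/funext => x; rewrite /dpar deriveD.
Qed.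

Lemma Ck_mul d u v : Ck d u -> Ck d v -> Ck d (u * v).
Proof.
elim: d u v => [|d IH] u v su sv.
  by move=> x; exact: (continuousM (su x) (sv x)).
have [su' sv'] := (CkS su, CkS sv); case: su sv => cu du [cv dv].
split; first by move=> x; exact: (continuousM (cu x) (cv x)).
move=> k; have [dvk svk] := dv k; have [duk suk] := du k.
split; first by move=> x; exact: derivableM.
rewrite (_ : dpar k (u * v) = dpar k u * v + u * dpar k v).
  by apply: Ck_add; exact: IH.
apply/funext => x; rewrite /dpar deriveM// addrC; congr (_ + _).
by rewrite -[LHS]/(_ * _) mulrC.
Qed.

Lemma CinfM u v : Cinf u -> Cinf v -> Cinf (u * v).
Proof. by move=> su sv d; exact: Ck_mul. Qed.

Lemma CinfD u v : Cinf u -> Cinf v -> Cinf (u + v).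
Proof. by move=> su sv d; exact: Ck_add. Qed.

Lemma CinfZ (c : R) u : Cinf u -> Cinf (c *: u).
Proof. by move=> su; apply: (CinfM (Cinf_cst c)). Qed.

Lemma Cinf0 : Cinf 0. Proof. exact: Cinf_cst. Qed.

Lemma Cinf_sum (I : Type) (s : seq I) (P : pred I) (F : I -> X -> R) :
  (forall i, Cinf (F i)) -> Cinf (\sum_(i <- s | P i) F i).
Proof. by move=> sF; elim/big_ind: _ => //; [exact: Cinf0|exact: CinfD]. Qed.

Lemma dpar_sum (I : Type) (s : seq I) (P : pred I) (F : I -> X -> R) k :
  (forall i, Cinf (F i)) ->
  dpar k (\sum_(i <- s | P i) F i) = \sum_(i <- s | P i) dpar k (F i).
Proof.
move=> sF; elim: s => [|i s IH]; first by rewrite !big_nil; exact: dpar_cst.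
rewrite !big_cons; case: (P i) => //.
by rewrite dparD ?IH//; exact: Cinf_sum.
Qed.

Lemma dpar_comm k l u : Cinf u -> dpar k (dpar l u) = dpar l (dpar k u).
Proof.
move=> su; apply: schwarz => [y|y|y|y|y|y]; try exact: Cinf_derivable.
- exact: Cinf_derivable (Cinf_dpar _ su).
- exact: Cinf_derivable (Cinf_dpar _ su).
- exact: (Cinf_continuous (Cinf_dpar k (Cinf_dpar l su))).
- exact: (Cinf_continuous (Cinf_dpar l (Cinf_dpar k su))).
Qed.

Lemma Cinf_is_derive u x (v : X) : Cinf u ->
  is_derive x v u (\sum_i \sum_j v i j * dpar (i, j) u x).
Proof.
move=> su; rewrite pair_bigA /= {1}(matrix_sum_delta v) pair_bigA /=.
have := is_derive_sum_dir (e := fun k : idx => delta_mx k.1 k.2) x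
  (index_enum _) (fun k => v k.1 k.2)
  (fun k y => Cinf_derivable (k := k) (x := y) su)
  (fun k => Cinf_continuous (Cinf_dpar k su)).
by under [X in is_derive _ _ _ X]eq_bigr => k _ do
  rewrite -[delta_mx k.1 k.2]/(delta_mx (k.1, k.2).1 (k.1, k.2).2).
Qed.

(* Total degree strictly less than [d]. *)
Fixpoint degle d u : Prop :=
  if d is e.+1 then forall k, degle e (dpar k u) else u = 0.

Lemma degle0 d : degle d 0.
Proof. by elim: d => //= d IH k; rewrite [dpar k 0]dpar_cst. Qed.

Lemma degleS d u : degle d u -> degle d.+1 u.
Proof.
elim: d u => [|d IH] u; last by move=> du k; exact: IH.
by move=> -> k /=; rewrite [dpar k 0]dpar_cst.
Qed.

Lemma degle_leq d e u : (d <= e)%N -> degle d u -> degle e u.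
Proof.
move=> /subnKC <-; elim: (e - d)%N => [|k IH]; first by rewrite addn0.
by rewrite addnS => /IH/degleS.
Qed.

Lemma degleD d u v : Cinf u -> Cinf v -> degle d u -> degle d v -> degle d (u + v).
Proof.
elim: d u v => [|d IH] u v su sv /=; first by move=> -> ->; rewrite addr0.
by move=> du dv k; rewrite dparD//; apply: IH => //; exact: Cinf_dpar.
Qed.

Lemma degleZ d c u : Cinf u -> degle d u -> degle d (c *: u).
Proof.
elim: d u => [|d IH] u su /=; first by move=> ->; rewrite scaler0.
by move=> du k; rewrite dparZ//; apply: IH => //; exact: Cinf_dpar.
Qed.

(** Each term of the Leibniz rule lowers one of the two bounds. The bound [d + e] is not sharp, but
    only the existence of some bound matters. *)
Lemma degleM d e u v : Cinf u -> Cinf v -> degle d u -> degle e v ->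
  degle (d + e) (u * v).
Proof.
elim: d e u v => [|d IHd] e u v su sv du dv.
  by rewrite [u]du mul0r; exact: degle0.
elim: e u v su sv du dv => [|e IHe] u v su sv du dv.
  by rewrite [v]dv mulr0; exact: degle0.
move=> k; rewrite dparM//.
apply: degleD; try (apply: CinfM => //; exact: Cinf_dpar).
  by apply: IHd => //; exact: Cinf_dpar.
by rewrite -addSnnS; apply: IHe => //; exact: Cinf_dpar.
Qed.

End SmoothFunctions.

(** * The Euler and Laplace operators and the heat operator *)

Section SmoothOperators.
Variables (R : realType) (m n : nat).
Local Notation X := 'M[R]_(m, n).
Local Notation idx := ('I_m * 'I_n)%type.
Implicit Types (u v w : X -> R) (T : (X -> R) -> (X -> R)).

(** Linearity is asked for smooth arguments only: [dpar] is a limit with a default value where the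
    derivative does not exist, so it is not additive on all functions. *)
Definition smlin T :=
  (forall u, Cinf u -> Cinf (T u)) /\
  (forall (c : R) u v, Cinf u -> Cinf v -> T (c *: u + v) = c *: T u + T v).

Section SmlinTheory.
Variables (T : (X -> R) -> (X -> R)) (linT : smlin T).

Lemma smlin_Cinf u : Cinf u -> Cinf (T u).
Proof. exact: linT.1. Qed.

Lemma smlin0 : T 0 = 0.
Proof.
have := linT.2 (-1) 0 0 (@Cinf0 _ _ _) (@Cinf0 _ _ _).
by rewrite scaler0 addr0 scaleN1r addNr.
Qed.

Lemma smlinD u v : Cinf u -> Cinf v -> T (u + v) = T u + T v.
Proof. by move=> su sv; have := linT.2 1 u v su sv; rewrite !scale1r. Qed.

Lemma smlinZ c u : Cinf u -> T (c *: u) = c *: T u.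
Proof.
move=> su; have := linT.2 c u 0 su (@Cinf0 _ _ _).
by rewrite !addr0 smlin0 addr0.
Qed.

Lemma smlin_sum (I : Type) (s : seq I) (P : pred I) (F : I -> X -> R) :
  (forall i, Cinf (F i)) ->
  T (\sum_(i <- s | P i) F i) = \sum_(i <- s | P i) T (F i).
Proof.
move=> sF; elim: s => [|i s IH]; first by rewrite !big_nil smlin0.
rewrite !big_cons; case: (P i) => //.
by rewrite smlinD ?IH//; exact: Cinf_sum.
Qed.

End SmlinTheory.

Lemma smlin_dpar k : smlin (@dpar R m n k).
Proof.
split=> [u|c u v su sv]; first exact: Cinf_dpar.
by rewrite dparD ?dparZ//; exact: CinfZ.
Qed.

Lemma smlin_id : smlin id.
Proof. by []. Qed.

Lemma smlin_comp T T' : smlin T -> smlin T' -> smlin (T \o T').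
Proof.
move=> linT linT'; split=> [u su|c u v su sv] /=.
  exact/linT.1/linT'.1.
by rewrite linT'.2// linT.2//; exact: linT'.1.
Qed.

Lemma smlin_iter T k : smlin T -> smlin (iter k T).
Proof.
by move=> linT; elim: k => [|k IH]; [exact: smlin_id|exact: (smlin_comp linT IH)].
Qed.

Lemma smlin_mul w T : Cinf w -> smlin T -> smlin (fun u => w * T u).
Proof.
move=> sw linT; split=> [u su|c u v su sv].
  by apply: CinfM => //; exact: linT.1.
by rewrite linT.2// mulrDr; congr (_ + _); apply/funext => x; exact: mulrCA.
Qed.

Lemma smlin_scale c T : smlin T -> smlin (fun u => c *: T u).
Proof.
move=> linT; split=> [u su|d u v su sv]; first exact/CinfZ/linT.1.
by rewrite linT.2// scalerDr !scalerA mulrC.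
Qed.

Lemma smlin_bigsum (I : Type) (s : seq I) (F : I -> (X -> R) -> (X -> R)) :
  (forall i, smlin (F i)) -> smlin (fun u => \sum_(i <- s) F i u).
Proof.
move=> linF; split=> [u su|c u v su sv].
  by apply: Cinf_sum => i; exact: (linF i).1.
rewrite scaler_sumr -big_split; apply: eq_bigr => i _; exact: (linF i).2.
Qed.

(* [eu], [lap], [trl] are the real counterparts of [euler], [laplace],
   [tr_laplace], with a symmetric matrix [S] in the role of [A^-1]. *)
Definition eu (i j : 'I_n) u : X -> R := \sum_(d < m) crd d i * dpar (d, j) u.

Lemma smlin_eu i j : smlin (eu i j).
Proof.
apply: smlin_bigsum => d; apply: smlin_mul; first exact: Cinf_crd.
exact: smlin_dpar.
Qed.

Variable S : 'M[R]_m.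

Definition lap (i j : 'I_n) u : X -> R :=
  \sum_(a < m) \sum_(b < m) S a b *: dpar (a, i) (dpar (b, j) u).

Definition trl u : X -> R := \sum_(i < n) lap i i u.

Lemma euE i j u U : eu i j u U = \sum_d U d i * dpar (d, j) u U.
Proof. by rewrite /eu fct_sumE. Qed.

Lemma lapE i j u U :
  lap i j u U = \sum_a \sum_b S a b * dpar (a, i) (dpar (b, j) u) U.
Proof. by rewrite /lap fct_sumE; apply: eq_bigr => a _; rewrite fct_sumE. Qed.

Lemma trlE u U : trl u U = \sum_i lap i i u U.
Proof. by rewrite /trl fct_sumE. Qed.

Lemma smlin_lap i j : smlin (lap i j).
Proof.
apply: smlin_bigsum => a; apply: smlin_bigsum => b; apply: smlin_scale.
exact: (smlin_comp (smlin_dpar _) (smlin_dpar _)).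
Qed.

Lemma smlin_trl : smlin trl.
Proof. by apply: smlin_bigsum => i; exact: smlin_lap. Qed.

Lemma dpar_eu k i j u : Cinf u ->
  dpar k (eu i j u) = eu i j (dpar k u) + (k.2 == i)%:R *: dpar (k.1, j) u.
Proof.
move=> su; rewrite dpar_sum; last first.
  by move=> d; apply: CinfM; [exact: Cinf_crd|exact: Cinf_dpar].
rewrite (eq_bigr (fun d => crd d i * dpar (d, j) (dpar k u) +
   (k == (d, i))%:R *: dpar (d, j) u)); last first.
  move=> d _; rewrite dparM; [|exact: Cinf_crd|exact: Cinf_dpar].
  by rewrite addrC dpar_comm// dpar_crd.
rewrite big_split /=; congr (_ + _); case: k => a b /=.
rewrite (bigD1 a)//= xpair_eqE eqxx big1 ?addr0// => d.
by rewrite xpair_eqE eq_sym => /negbTE ->; rewrite scale0r.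
Qed.

Lemma dpar_sum_eu k u : Cinf u ->
  dpar k (\sum_i eu i i u) = \sum_i eu i i (dpar k u) + dpar k u.
Proof.
move=> su; rewrite dpar_sum; last by move=> i; exact: smlin_Cinf (smlin_eu i i) _ su.
rewrite (eq_bigr _ (fun i _ => dpar_eu k i i su)) big_split /=; congr (_ + _).
rewrite (bigD1 k.2)//= eqxx scale1r big1 ?addr0 -?surjective_pairing// => i.
by rewrite eq_sym => /negbTE ->; rewrite scale0r.
Qed.

Lemma dpar_lap k i j u : Cinf u -> dpar k (lap i j u) = lap i j (dpar k u).
Proof.
move=> su; have sdd a b : Cinf (S a b *: dpar (a, i) (dpar (b, j) u)).
  exact/CinfZ/Cinf_dpar/Cinf_dpar.
rewrite dpar_sum; last by move=> a; exact: Cinf_sum.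
apply: eq_bigr => a _; rewrite dpar_sum//; apply: eq_bigr => b _.
rewrite dparZ; last exact/Cinf_dpar/Cinf_dpar.
by rewrite dpar_comm ?[dpar k (dpar (b, j) u)]dpar_comm//; exact: Cinf_dpar.
Qed.

Lemma lap_lap i j i' j' u : Cinf u -> lap i j (lap i' j' u) = lap i' j' (lap i j u).
Proof.
move=> su; have lin := smlin_lap i' j'.
have sd b : Cinf (dpar (b, j) u) by exact: Cinf_dpar.
have sdd a b : Cinf (dpar (a, i) (dpar (b, j) u)) by exact: Cinf_dpar.
have szdd a b : Cinf (S a b *: dpar (a, i) (dpar (b, j) u)) by exact: CinfZ.
rewrite [X in _ = lap _ _ X]/lap (smlin_sum lin)//; last by move=> a; exact: Cinf_sum.
apply: eq_bigr => a _; rewrite (smlin_sum lin)//; apply: eq_bigr => b _.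
by rewrite (smlinZ lin)// dpar_lap ?dpar_lap.
Qed.

Lemma lap_trl i j u : Cinf u -> lap i j (trl u) = trl (lap i j u).
Proof.
move=> su; rewrite (smlin_sum (smlin_lap i j)); last first.
  by move=> k; exact: smlin_Cinf (smlin_lap _ _) _ su.
by apply: eq_bigr => k _; exact: lap_lap.
Qed.

Lemma dpar_trl k u : Cinf u -> dpar k (trl u) = trl (dpar k u).
Proof.
move=> su; rewrite dpar_sum; last first.
  by move=> i; exact: smlin_Cinf (smlin_lap _ _) _ su.
by apply: eq_bigr => i _; exact: dpar_lap.
Qed.

Lemma lap_iter_trl i j k u : Cinf u ->
  lap i j (iter k trl u) = iter k trl (lap i j u).
Proof.
move=> su; elim: k => //= k IH.
by rewrite lap_trl ?IH//; exact: smlin_Cinf (smlin_iter k smlin_trl) _ su.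
Qed.

Hypothesis Ssym : S^T = S.

(** Each of the two derivatives in [lap k k] may hit the coefficient [crd d i], which leaves two
    first-order corrections. They coincide because [S] is symmetric and partial derivatives commute
    ([flip]); hence the factor 2. *)
Lemma trl_eu i j u : Cinf u -> trl (eu i j u) = eu i j (trl u) + 2 *: lap i j u.
Proof.
move=> su; have lin := smlin_eu i j.
have sd k : Cinf (dpar k u) by exact: Cinf_dpar.
have sdd k l : Cinf (dpar k (dpar l u)) by exact: Cinf_dpar.
have sl k l : Cinf (lap k l u) by exact: smlin_Cinf (smlin_lap _ _) _ su.
have step (k : 'I_n) : lap k k (eu i j u) = eu i j (lap k k u) +
    (k == i)%:R *: (2 *: lap i j u).
  have flip : \sum_a \sum_b S a b *: dpar (a, j) (dpar (b, i) u) = lap i j u.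
    rewrite exchange_big; apply: eq_bigr => a _; apply: eq_bigr => b _.
    by rewrite -{1}Ssym mxE dpar_comm.
  have -> : (k == i)%:R *: (2 *: lap i j u) = \sum_a \sum_b S a b *:
      ((k == i)%:R *: (dpar (a, j) (dpar (b, k) u) + dpar (a, k) (dpar (b, j) u))).
    have [->|_] := eqVneq k i; last first.
      rewrite mulr0n scale0r; apply/esym/big1 => a _; apply: big1 => b _.
      by rewrite scale0r scaler0.
    rewrite scale1r scaler_nat mulr2n -{1}flip -big_split; apply: eq_bigr => a _.
    by rewrite -big_split; apply: eq_bigr => b _; rewrite scale1r scalerDr.
  rewrite {2}/lap (smlin_sum lin); last first.
    by move=> a; apply: Cinf_sum => b; exact: CinfZ.
  rewrite -big_split; apply: eq_bigr => a _.
  rewrite (smlin_sum lin); last by move=> b; exact: CinfZ.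
  rewrite -big_split; apply: eq_bigr => b _.
  rewrite /= (smlinZ lin); last exact: sdd.
  rewrite -scalerDr; congr (S a b *: _).
  have se l : Cinf (eu i j (dpar l u)) by exact: smlin_Cinf lin _ (sd l).
  have sz c l : Cinf (c *: dpar l u) by exact: CinfZ.
  rewrite (dpar_eu _ _ _ su) (dparD _ (se _) (sz _ _)) (dpar_eu _ _ _ (sd _)).
  by rewrite (dparZ _ _ (sd _)) /= scalerDr addrA.
rewrite (smlin_sum lin)// {1}/trl (eq_bigr _ (fun k _ => step k)) big_split /=.
congr (_ + _); rewrite (bigD1 i)//= eqxx scale1r big1 ?addr0// => k.
by move=> /negbTE ->; rewrite scale0r.
Qed.

(** The commutator [lap i j] itself commutes with [trl], so [k] commutations give [k] equal terms.
    At [k = 0] the coefficient vanishes and the truncated predecessor is harmless. *)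
Lemma eu_iter_trl i j k u : Cinf u ->
  eu i j (iter k trl u) =
  iter k trl (eu i j u) - (2 * k%:R) *: iter k.-1 trl (lap i j u).
Proof.
move=> su; elim: k => [|k IH]; first by rewrite /= mulr0 scale0r subr0.
have sk : Cinf (iter k trl u) by exact: smlin_Cinf (smlin_iter k smlin_trl) _ su.
have sl : Cinf (lap i j u) by exact: smlin_Cinf (smlin_lap _ _) _ su.
have se : Cinf (eu i j u) by exact: smlin_Cinf (smlin_eu _ _) _ su.
have -> : eu i j (iter k.+1 trl u) =
    trl (eu i j (iter k trl u)) - 2 *: lap i j (iter k trl u).
  by rewrite trl_eu// addrK.
rewrite lap_iter_trl// IH.
have -> : trl (iter k trl (eu i j u) - (2 * k%:R) *: iter k.-1 trl (lap i j u)) =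
   trl (iter k trl (eu i j u)) - (2 * k%:R) *: iter k trl (lap i j u).
  rewrite -scaleNr (smlinD smlin_trl); first last.
  - exact/CinfZ/(smlin_Cinf (smlin_iter _ smlin_trl)).
  - exact/(smlin_Cinf (smlin_iter _ smlin_trl)).
  rewrite (smlinZ smlin_trl); last exact/(smlin_Cinf (smlin_iter _ smlin_trl)).
  by rewrite scaleNr; case: (k) => [|k']; rewrite ?mulr0 ?scale0r.
rewrite /= -addrA; congr (_ + _).
by rewrite -opprD -scalerDl -[k.+1%:R]natr1 mulrDr mulr1.
Qed.

(** Truncating the exponential gives an operator without limits; it agrees with the full series on
    functions killed by [iter K trl]. *)
Definition texp (c : R) (K : nat) u : X -> R :=
  \sum_(k < K) (c ^+ k / k`!%:R) *: iter k trl u.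

Lemma smlin_texp c K : smlin (texp c K).
Proof.
by apply: smlin_bigsum => k; apply: smlin_scale; apply: smlin_iter; exact: smlin_trl.
Qed.

Lemma lap_texp c K i j u : Cinf u -> lap i j (texp c K u) = texp c K (lap i j u).
Proof.
move=> su; have si k : Cinf (iter k trl u).
  by exact: smlin_Cinf (smlin_iter k smlin_trl) _ su.
rewrite (smlin_sum (smlin_lap i j)); last by move=> k; exact: CinfZ.
apply: eq_bigr => k _.
by rewrite (smlinZ (smlin_lap i j))// lap_iter_trl.
Qed.

(** The truncation [K.+1] instead of [K] matters: [iter K trl u = 0] need not give
    [iter K trl (eu i j u) = 0], since the commutator leaves a term with one [trl] fewer. *)
Lemma eu_texp c K i j u : Cinf u -> iter K trl u = 0 ->
  eu i j (texp c K.+1 u) =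
  texp c K.+1 (eu i j u) - (2 * c) *: lap i j (texp c K.+1 u).
Proof.
move=> su uK; have si k : Cinf (iter k trl u).
  by exact: smlin_Cinf (smlin_iter k smlin_trl) _ su.
rewrite (smlin_sum (smlin_eu i j)); last by move=> k; exact: CinfZ.
rewrite (eq_bigr (fun k : 'I_K.+1 => (c ^+ k / k`!%:R) *: iter k trl (eu i j u) -
  (c ^+ k / k`!%:R * (2 * k%:R)) *: iter k.-1 trl (lap i j u))); last first.
  by move=> k _; rewrite (smlinZ (smlin_eu i j))// eu_iter_trl// scalerBr scalerA.
rewrite sumrB; congr (_ - _).
rewrite big_ord_recl /= mulr0 mulr0 scale0r add0r lap_texp// /texp.
(* After the index shift the top term of the right-hand sum has no partner; it is [lap i j] of
   [iter K trl u], which is 0. *)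
rewrite [in RHS]big_ord_recr /= -lap_iter_trl// uK (smlin0 (smlin_lap i j)).
rewrite scaler0 addr0 scaler_sumr; apply: eq_bigr => k _; rewrite scalerA /bump /=.
rewrite add1n /=; congr (_ *: _).
rewrite factS natrM exprS invfM; field.
by rewrite addrC natr1 !pnatr_eq0 -lt0n fact_gt0.
Qed.

Lemma iter_trl_ge0 u K k : iter K trl u = 0 -> (K <= k)%N -> iter k trl u = 0.
Proof.
move=> uK /subnK <-; rewrite iterD uK; elim: (k - K)%N => //= e ->.
exact: smlin0 smlin_trl.
Qed.

(** Cauchy product of truncated series: the square of indices is summed along antidiagonals, and its
    part with [i + j >= K] is killed by the hypothesis. *)
Lemma sum_conv (V : lmodType R) (a b : nat -> R) (w : nat -> V) K :
  (forall k, (K <= k)%N -> w k = 0) ->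
  \sum_(i < K) \sum_(j < K) (a i * b j) *: w (i + j)%N =
  \sum_(N < K) (\sum_(i < N.+1) a i * b (N - i)%N) *: w N.
Proof.
move=> wK.
have shift (F : nat -> V) (p : nat) :
    \sum_(p <= N < K) F N = \sum_(0 <= j < K - p) F (j + p)%N.
  by rewrite -{1}[p]add0n big_addn.
transitivity (\sum_(i < K) \sum_(N < K | (i <= N)%N) (a i * b (N - i)%N) *: w N).
  apply: eq_bigr => i _; have iK := ltnW (ltn_ord i).
  rewrite -(big_geq_mkord i K xpredT (fun N => (a i * b (N - i)%N) *: w N)).
  rewrite shift.
  rewrite -(big_mkord xpredT (fun j => (a i * b j) *: w (i + j)%N)).
  rewrite (big_cat_nat _ (leq_subr i K))//= [X in _ + X]big_nat_cond.
  rewrite [X in _ + X]big1 ?addr0; last first.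
    by move=> j /andP[/andP[Kj _] _]; rewrite wK ?scaler0// -leq_subLR.
  by apply: eq_bigr => j _; rewrite addnK addnC.
rewrite (exchange_big_dep xpredT)//=; apply: eq_bigr => N _.
by rewrite scaler_suml (big_ord_widen K (fun i => (a i * b (N - i)%N) *: w N)).
Qed.

(** By the binomial theorem the coefficient of [iter N trl u] in the product is (c - c)^N / N!, so
    only [N = 0] survives. *)
Lemma texpK c K u : Cinf u -> iter K trl u = 0 -> texp c K (texp (- c) K u) = u.
Proof.
move=> su uK; have si k : Cinf (iter k trl u).
  by exact: smlin_Cinf (smlin_iter k smlin_trl) _ su.
transitivity (\sum_(i < K) \sum_(j < K)
    ((c ^+ i / i`!%:R) * ((- c) ^+ j / j`!%:R)) *: iter (i + j)%N trl u).
  apply: eq_bigr => i _.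
  rewrite (smlin_sum (smlin_iter i smlin_trl)); last by move=> k; exact: CinfZ.
  rewrite scaler_sumr; apply: eq_bigr => j _.
  by rewrite (smlinZ (smlin_iter i smlin_trl))// -iterD scalerA.
rewrite (sum_conv (fun i => c ^+ i / i`!%:R) (fun j => (- c) ^+ j / j`!%:R));
  last by move=> k; exact: iter_trl_ge0.
rewrite (eq_bigr (fun N : 'I_K => ((N == 0 :> nat)%:R) *: iter N trl u)).
  (* For [K = 0] the empty sum is correct because the hypothesis then reads [u = 0]. *)
  case: K uK => [|K] uK; first by rewrite big_ord0 -uK.
  by rewrite big_ord_recl /= scale1r big1 ?addr0// => i _; rewrite scale0r.
move=> N _; congr (_ *: _).
transitivity ((N`!%:R)^-1 * (- c + c) ^+ N); last first.
  by rewrite addNr expr0n; case: eqP => [->|_]; rewrite ?mulr0// fact0 invr1 mulr1.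
rewrite exprDn mulr_sumr; apply: eq_bigr => i _.
have iN : (i <= N)%N by rewrite -ltnS.
have f0 (k : nat) : k`!%:R != 0 :> R by rewrite pnatr_eq0 -lt0n fact_gt0.
rewrite -[_ *+ 'C(N, i)]mulr_natr.
have -> : ('C(N, i))%:R = N`!%:R / (i`!%:R * (N - i)`!%:R) :> R.
  by rewrite -(bin_fact iN) natrM natrM mulfK ?mulf_neq0.
by field; rewrite !f0.
Qed.

End SmoothOperators.

(** * Real polynomials: nilpotent derivatives and Taylor expansion *)

Section Polynomials.
Variables (R : realType) (m n : nat).
Local Notation X := 'M[R]_(m, n).
Local Notation idx := ('I_m * 'I_n)%type.
Implicit Types (u v w : X -> R).

Lemma degle_sum d (I : Type) (s : seq I) (F : I -> X -> R) :
  (forall i, Cinf (F i)) -> (forall i, degle d (F i)) ->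
  degle d (\sum_(i <- s) F i).
Proof.
move=> sF dF; elim: s => [|i s IH]; first by rewrite big_nil; exact: degle0.
by rewrite big_cons; apply: degleD => //; exact: Cinf_sum.
Qed.

Lemma degle_dpar d k u : degle d u -> degle d (dpar k u).
Proof.
case: d => [/= ->|d du]; first by rewrite [dpar k 0]dpar_cst.
exact/degleS/du.
Qed.

Lemma iter_degle (T : (X -> R) -> (X -> R)) d u : smlin T ->
  (forall e v, Cinf v -> degle e.+1 v -> degle e (T v)) ->
  Cinf u -> degle d u -> iter d T u = 0.
Proof.
move=> linT dT; elim: d u => [|d IH] u su du //.
by rewrite iterSr; apply: IH; [exact: (smlin_Cinf linT)|exact: dT].
Qed.

Lemma iter_trl_degle (S : 'M[R]_m) d u : Cinf u -> degle d u ->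
  iter d (trl S) u = 0.
Proof.
apply: iter_degle; first exact: smlin_trl.
(* [trl] lowers the degree by two; lowering by one suffices, and the second derivative is absorbed
   by [degle_dpar]. *)
move=> e v sv dv; have sdd k l c : Cinf (c *: dpar k (dpar l v)).
  exact/CinfZ/Cinf_dpar/Cinf_dpar.
apply: degle_sum => i; first exact: smlin_Cinf (smlin_lap _ _ _) _ sv.
apply: degle_sum => a; first exact: Cinf_sum.
apply: degle_sum => b //; apply: degleZ; first exact/Cinf_dpar/Cinf_dpar.
exact: degle_dpar (dv _).
Qed.

Definition dirD (e : X) u : X -> R := \sum_k e k.1 k.2 *: dpar k u.

Lemma smlin_dirD e : smlin (dirD e).
Proof. by apply: smlin_bigsum => k; apply: smlin_scale; exact: smlin_dpar. Qed.

Lemma is_derive_dirD e u (x : X) : Cinf u -> is_derive x e u (dirD e u x).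
Proof.
move=> su; have := Cinf_is_derive x e su; rewrite pair_bigA /=.
rewrite /dirD fct_sumE; congr is_derive.
Qed.

(** Taylor's formula without remainder. The family [phi] stands for the successive derivatives; the
    induction drops its first member, and the polynomial [p] is the antiderivative of the expansion
    of [phi 1] with the right value at 0. *)
Lemma taylor_degle (phi : nat -> R -> R) d :
  (forall k (t : R), is_derive t (1 : R) (phi k) (phi k.+1 t)) ->
  phi d = 0 -> forall t, phi 0 t = \sum_(k < d) phi k 0 / k`!%:R * t ^+ k.
Proof.
elim: d phi => [|d IH] phi dphi phid t; first by rewrite big_ord0 phid.
have {}IH := IH (fun k => phi k.+1) (fun k => dphi k.+1) phid.
pose p := \poly_(k < d.+1) (phi k 0 / k`!%:R).
have p'E s : p^`().[s] = phi 1 s.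
  rewrite IH (_ : p^`() = \poly_(k < d) (phi k.+1 0 / k`!%:R)) ?horner_poly//.
  apply/polyP => i; rewrite coef_deriv !coef_poly ltnS.
  case: ltnP => // _; rewrite ?mul0rn// -mulr_natr factS natrM; field.
  by rewrite addrC natr1 !pnatr_eq0 -lt0n fact_gt0.
have dg (s : R) : is_derive s (1 : R) (fun r => phi 0 r - p.[r]) 0.
  by rewrite -(subrr (phi 1 s)) -{2}p'E; apply: is_deriveB.
have := is_derive_0_is_cst t 0 dg.
rewrite horner_coef0 coef_poly /= fact0 divr1 subrr => /eqP.
by rewrite subr_eq0 horner_poly => /eqP.
Qed.

Lemma taylor_dirD d u : Cinf u -> degle d u -> forall e,
  u e = \sum_(k < d) iter k (dirD e) u 0 / k`!%:R.
Proof.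
move=> su du e; have linD := smlin_dirD e.
pose phi k (t : R) := iter k (dirD e) u (t *: e).
have dphi k (t : R) : is_derive t (1 : R) (phi k) (phi k.+1 t).
  have sk := smlin_Cinf (smlin_iter k linD) su.
  have := is_derive_line (is_derive_dirD e (0 + t *: e) sk).
  rewrite /phi /= add0r; congr is_derive.
  by apply/funext => s; rewrite add0r.
have phid : phi d = 0.
  apply/funext => t; rewrite /phi (iter_degle linD _ su du)// => c v sv dv.
  apply: degle_sum => k; first exact/CinfZ/Cinf_dpar.
  by apply: degleZ; [exact: Cinf_dpar|exact: dv].
have := taylor_degle dphi phid 1; rewrite {1}/phi scale1r /= => ->.
by apply: eq_bigr => k _; rewrite expr1n mulr1 /phi scale0r.
Qed.

(** Generation from constants and coordinates gives an induction principle, by which smoothness,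
    degree bounds and growth bounds are proved. *)
Inductive polyR : (X -> R) -> Prop :=
| polyR_cst c : polyR (cst c)
| polyR_crd i j : polyR (crd i j)
| polyRD u v : polyR u -> polyR v -> polyR (u + v)
| polyRM u v : polyR u -> polyR v -> polyR (u * v).

Lemma polyRZ c u : polyR u -> polyR (c *: u).
Proof. exact: (polyRM (polyR_cst c)). Qed.

Lemma polyR_sum (I : Type) (s : seq I) (P : pred I) (F : I -> X -> R) :
  (forall i, polyR (F i)) -> polyR (\sum_(i <- s | P i) F i).
Proof.
by move=> pF; elim/big_ind: _ => //; [exact: polyR_cst|exact: polyRD].
Qed.

Lemma polyR_Cinf u : polyR u -> Cinf u.
Proof.
elim=> {u} [c|i j|u v _ + _|u v _ + _].
- exact: Cinf_cst.
- exact: Cinf_crd.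
- exact: CinfD.
- exact: CinfM.
Qed.

Lemma polyR_degle u : polyR u -> exists d, degle d u.
Proof.
elim=> {u} [c|i j|u v pu [d du] pv [e dv]|u v pu [d du] pv [e dv]].
- by exists 1%N => k /=; rewrite dpar_cst.
- by exists 2%N => k l /=; rewrite dpar_crd dpar_cst.
- have [su sv] := (polyR_Cinf pu, polyR_Cinf pv).
  exists (maxn d e); apply: degleD => //.
    by apply: degle_leq du; exact: leq_maxl.
  by apply: degle_leq dv; exact: leq_maxr.
- by exists (d + e)%N; apply: degleM => //; exact: polyR_Cinf.
Qed.

Lemma polyR_dpar u k : polyR u -> polyR (dpar k u).
Proof.
elim=> {u} [c|i j|u v pu du pv dv|u v pu du pv dv].
- by rewrite dpar_cst; exact: polyR_cst.
- by rewrite dpar_crd; exact: polyR_cst.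
- by rewrite dparD; [exact: polyRD|exact: polyR_Cinf..].
- rewrite dparM; [|exact: polyR_Cinf..].
  by apply: polyRD; exact: polyRM.
Qed.

(** Taylor expansion at 0, read in the direction [e]: each [dirD e] contributes the coordinates of
    [e] as coefficients, so the iterated derivatives at the fixed point 0 are polynomials in [e]. *)
Lemma degle_polyR d u : Cinf u -> degle d u -> polyR u.
Proof.
move=> su du.
have pk k w : Cinf w -> polyR (fun e => iter k (dirD e) w 0).
  elim: k w => [|k IH] w sw; first exact: polyR_cst.
  have -> : (fun e => iter k.+1 (dirD e) w 0) =
      \sum_l crd l.1 l.2 * (fun e => iter k (dirD e) (dpar l w) 0).
    apply/funext => e; rewrite iterSr {2}/dirD.
    have sd l : Cinf (dpar l w) by exact: Cinf_dpar.
    rewrite (smlin_sum (smlin_iter k (smlin_dirD e))); last first.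
      by move=> l; exact: CinfZ.
    rewrite !fct_sumE; apply: eq_bigr => l _.
    by rewrite (smlinZ (smlin_iter k (smlin_dirD e))).
  apply: polyR_sum => l; apply: polyRM; first exact: polyR_crd.
  exact/IH/Cinf_dpar.
have -> : u = \sum_(k < d) (k`!%:R)^-1 *: (fun e => iter k (dirD e) u 0).
  apply/funext => e; rewrite {1}(taylor_dirD su du) fct_sumE.
  by apply: eq_bigr => k _; rewrite mulrC.
by apply: polyR_sum => k; apply: polyRZ; exact: pk.
Qed.

End Polynomials.

(** * The maximum principle *)

Section PositiveForms.
Variables (R : realType) (m : nat).
Implicit Types (S H : 'M[R]_m) (x y : 'I_m -> R).

Definition bform S x y : R := \sum_a \sum_b S a b * (x a * y b).

Definition psd S := forall x, 0 <= bform S x x.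

Lemma bformDr S x y z (c : R) :
  bform S x (fun b => c * y b + z b) = c * bform S x y + bform S x z.
Proof.
rewrite mulr_sumr -big_split; apply: eq_bigr => a _.
by rewrite mulr_sumr -big_split; apply: eq_bigr => b _ /=; ring.
Qed.

Lemma bformDl S x y z (c : R) :
  bform S (fun b => c * y b + z b) x = c * bform S y x + bform S z x.
Proof.
rewrite mulr_sumr -big_split; apply: eq_bigr => a _.
by rewrite mulr_sumr -big_split; apply: eq_bigr => b _ /=; ring.
Qed.

Lemma bformC S x y : S^T = S -> bform S x y = bform S y x.
Proof.
move=> sS; rewrite /bform exchange_big; apply: eq_bigr => a _.
by apply: eq_bigr => b _; rewrite -{1}sS mxE [x b * _]mulrC.
Qed.

(** The form is nonnegative on [c * x + y] for every [c]. It is only semidefinite, so the quadratic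
    in [c] can degenerate to a linear function, which is treated apart. *)
Lemma psd_cauchy S x y : S^T = S -> psd S ->
  bform S x y ^+ 2 <= bform S x x * bform S y y.
Proof.
have key (a b : R) : 0 <= b -> a *+ 2 != 0 ->
    0 <= - (b + 1) / (a *+ 2) * a *+ 2 + b -> False.
  by move=> b0 a0; rewrite -mulrnAr divfK//; lra.
move=> sS pS.
have expand (c : R) : 0 <= c ^+ 2 * bform S x x + c * bform S x y *+ 2 + bform S y y.
  have := pS (fun b => c * x b + y b).
  rewrite bformDr (bformDl S x) (bformDl S y) (bformC y x sS).
  by congr (_ <= _); ring.
have [x0|x0] := eqVneq (bform S x x) 0.
  rewrite x0 mul0r; case: (eqVneq (bform S x y) 0) => [->|xy0].
    by rewrite expr0n.
  (* At this [c] the linear function with nonzero slope takes the value -1. *)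
  have := expand (- (bform S y y + 1) / (bform S x y *+ 2)).
  have xy2 : bform S x y *+ 2 != 0 by rewrite mulrn_eq0.
  by rewrite x0 mulr0 add0r => /(key _ _ (pS y) xy2).
have xp : 0 < bform S x x by rewrite lt_neqAle eq_sym x0 pS.
(* The minimizer of the quadratic. *)
have := expand (- bform S x y / bform S x x).
rewrite -(ler_pM2l xp) mulr0 => /le_trans - /(_ _ (lexx _)).
rewrite (_ : bform S x x * (_ + _) = bform S x x * bform S y y - bform S x y ^+ 2).
  by rewrite subr_ge0.
by field.
Qed.

Definition unitv (i : 'I_m) : 'I_m -> R := fun a => (a == i)%:R.

Lemma bform_unitl S i y : bform S (unitv i) y = \sum_b S i b * y b.
Proof.
rewrite /bform (bigD1 i)//= [X in _ + X]big1 ?addr0 => [|a /negbTE ai].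
  by apply: eq_bigr => b _; rewrite /unitv eqxx mul1r.
by rewrite big1// => b _; rewrite /unitv ai mul0r mulr0.
Qed.

Lemma bform_unit S i j : bform S (unitv i) (unitv j) = S i j.
Proof.
rewrite bform_unitl (bigD1 j)//= big1 => [|b /negbTE bj].
  by rewrite /unitv eqxx mulr1 addr0.
by rewrite /unitv bj mulr0.
Qed.

(* Symmetric Gaussian elimination writes S as a nonnegative combination of
   rank-one squares, and H is nonpositive on each of them. *)
Lemma psd_contract S H : S^T = S -> psd S ->
  (forall x, bform H x x <= 0) -> \sum_a \sum_b S a b * H a b <= 0.
Proof.
move=> sS pS nH.
suff elim (s : seq 'I_m) S' : S'^T = S' -> psd S' ->
    (forall a b, a \notin s -> S' a b = 0) ->
    \sum_a \sum_b S' a b * H a b <= 0.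
  by apply: (elim (enum 'I_m)) => // a b; rewrite mem_enum.
elim: s S' => [|i s IH] S' sS' pS' s0.
  by rewrite big1// => a _; rewrite big1// => b _; rewrite s0 ?mul0r.
have [i0|i0] := eqVneq (S' i i) 0.
  apply: IH => // a b as'; have [->|ai] := eqVneq a i; last first.
    by apply: s0; rewrite inE negb_or ai.
  have := psd_cauchy (unitv i) (unitv b) sS' pS'.
  rewrite !bform_unit i0 mul0r => h; apply/eqP.
  by rewrite -sqrf_eq0 eq_le h sqr_ge0.
have ip : 0 < S' i i by rewrite lt_neqAle eq_sym i0 -bform_unit pS'.
have symE a b : S' a b = S' b a by rewrite -{1}sS' mxE.
(* The Schur complement of the pivot; Cauchy-Schwarz against [unitv i] is exactly its
   semidefiniteness. *)
pose S2 : 'M[R]_m := \matrix_(a, b) (S' a b - S' i a * S' i b / S' i i).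
have S2E x : bform S2 x x = bform S' x x - bform S' (unitv i) x ^+ 2 / S' i i.
  rewrite bform_unitl expr2 mulr_suml mulr_suml /bform -sumrB.
  apply: eq_bigr => a _; rewrite mulr_sumr mulr_suml -sumrB.
  by apply: eq_bigr => b _; rewrite mxE; ring.
have -> : \sum_a \sum_b S' a b * H a b = \sum_a \sum_b S2 a b * H a b +
    (S' i i)^-1 * bform H (S' i) (S' i).
  rewrite mulr_sumr -big_split; apply: eq_bigr => a _.
  rewrite mulr_sumr -big_split; apply: eq_bigr => b _ /=; rewrite mxE; ring.
rewrite -[leRHS]addr0 lerD//; last by rewrite pmulr_rle0 ?invr_gt0.
apply: IH.
- by apply/matrixP => a b; rewrite !mxE symE [S' i a * _]mulrC.
- move=> x; rewrite S2E subr_ge0 ler_pdivrMr//.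
  by have := psd_cauchy (unitv i) x sS' pS'; rewrite bform_unit mulrC.
- move=> a b as'; rewrite mxE; have [->|ai] := eqVneq a i.
    by rewrite mulrAC divff// mul1r subrr.
  have sa c : S' a c = 0 by apply: s0; rewrite inE negb_or ai.
  by rewrite [S' i a]symE !sa !mul0r subr0.
Qed.

End PositiveForms.

Section MaximumPrinciple.
Variables (R : realType) (m n : nat).
Local Notation X := 'M[R]_(m, n).
Implicit Types (u g : X -> R) (U : X).

Lemma le_mx_norm p q (M : 'M[R]_(p, q)) i j : `|M i j| <= `|M|.
Proof.
rewrite [leRHS]/Num.Def.normr /= mx_normrE.
exact: (le_bigmax _ (fun k : 'I_p * 'I_q => `|M k.1 k.2|) (i, j)).
Qed.

Lemma decay_max g x0 (K : R) : continuous g -> 0 < g x0 ->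
  (forall i j U, `|U i j * g U| <= K) -> exists x, forall U, g U <= g x.
Proof.
move=> cg g0 decay.
(* Where [g U >= g x0 > 0], the decay bound confines every coordinate of [U] to [[-B, B]]; a maximum
   over this box is therefore global. *)
pose B := K / g x0.
have far U : g x0 <= g U -> forall i j, `|U i j| <= B.
  move=> gU i j; rewrite /B ler_pdivlMr//.
  rewrite (le_trans _ (decay i j U))// normrM ler_wpM2l//.
  exact: le_trans gU (ler_norm _).
(* The extreme value theorem is applied on a box of row vectors, hence the transport along
   [vec_mx]. *)
pose f (v : 'rV[R]_(m * n)) := g (vec_mx v).
have cv : continuous (vec_mx : 'rV[R]_(m * n) -> X).
  move=> v N /nbhs_ballP[e /= e0 eN]; apply/nbhs_ballP; exists e => //= w.
  rewrite -ball_normE /= => vw; apply: eN; rewrite -ball_normE /= -linearB.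
  rewrite (le_lt_trans _ vw)// [leLHS]/Num.Def.normr /= mx_normrE.
  by apply: bigmax_le => //= -[i j] _; rewrite mxE /=; exact: le_mx_norm.
pose A : set 'rV[R]_(m * n) := [set v | forall k, `[-B, B]%classic (v ord0 k)].
have cA : compact A by apply: (rV_compact (A := fun=> _)) => _; exact: segment_compact.
have A0 : A (mxvec x0).
  move=> k; case/mxvec_indexP: k => i j.
  by rewrite mxvecE /= in_itv /= -ler_norml; apply: far.
have cf : {within A, continuous f}.
  by apply: continuous_subspaceT => v; apply: continuous_comp; [exact: cv|exact: cg].
have [c cA' cmax] := EVT_max_rV (ex_intro _ _ A0) cA cf.
exists (vec_mx c) => U; rewrite leNgt; apply/negP => cU.
have : g x0 <= g (vec_mx c).
  by have := cmax (mxvec x0) (mem_set A0); rewrite /f mxvecK.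
move=> x0c; have /far UB : g x0 <= g U by exact: le_trans x0c (ltW cU).
have AU : A (mxvec U).
  move=> k; case/mxvec_indexP: k => i j.
  by rewrite mxvecE /= in_itv /= -ler_norml.
have := cmax _ (mem_set AU); rewrite /f mxvecK => /(lt_le_trans cU).
by rewrite ltxx.
Qed.

(** For each column [j] the Hessian [H] in the entries of that column is negative semidefinite: its
    value on [v] is the second derivative of [g] along the matrix [V] with column [j] equal to [v]
    and zeros elsewhere. *)
Lemma trl_at_max (S : 'M[R]_m) g x : S^T = S -> psd S -> Cinf g ->
  (forall U, g U <= g x) -> trl S g x <= 0.
Proof.
move=> sS pS sg gmax; rewrite /trl fct_sumE; apply: sumr_le0 => j _.
rewrite /lap fct_sumE.
pose H : 'M[R]_m := \matrix_(a, b) dpar (a, j) (dpar (b, j) g) x.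
rewrite (eq_bigr (fun a => \sum_b S a b * H a b)); last first.
  by move=> a _; rewrite fct_sumE; apply: eq_bigr => b _; rewrite mxE.
apply: psd_contract => // v.
pose V : X := \matrix_(a, l) (v a * (l == j)%:R).
have DEx u y : Cinf u -> 'D_V u y = (\sum_a v a *: dpar (a, j) u) y.
  move=> su; rewrite (is_derive_val (Cinf_is_derive y V su)).
  rewrite fct_sumE; apply: eq_bigr => a _; rewrite (bigD1 j)//= mxE eqxx mulr1.
  rewrite big1 ?addr0// => l /negbTE lj.
  by rewrite mxE lj mulr0 mul0r.
have DE u : Cinf u -> 'D_V u = \sum_a v a *: dpar (a, j) u.
  by move=> su; apply/funext => y; exact: DEx.
have linD : smlin (fun u => \sum_a v a *: dpar (a, j) u).
  by apply: smlin_bigsum => a; apply: smlin_scale; exact: smlin_dpar.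
have sD : Cinf (\sum_a v a *: dpar (a, j) g) by exact: (linD.1 _ sg).
have -> : bform H v v = 'D_V ('D_V g) x.
  rewrite (DE _ sg) (DEx _ _ sD) fct_sumE /bform; apply: eq_bigr => a _.
  rewrite dpar_sum; last by move=> b; exact/CinfZ/Cinf_dpar.
  transitivity (v a * (\sum_b dpar (a, j) (v b *: dpar (b, j) g)) x); last by [].
  rewrite fct_sumE mulr_sumr; apply: eq_bigr => b _.
  rewrite dparZ; last exact: Cinf_dpar.
  by rewrite mxE [_ *: _]lock /= -lock mulrC -mulrA.
apply: second_derive_at_max => //.
- by move=> y; exact: is_derive_derivable (Cinf_is_derive y V sg).
- by move=> y; rewrite DE//; exact: is_derive_derivable (Cinf_is_derive y V sD).
- by rewrite DE// DE//; apply: Cinf_continuous; exact: (linD.1 _ sD).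
Qed.

Lemma max_principle (S : 'M[R]_m) g (w : X -> R) (K : R) :
  S^T = S -> psd S -> Cinf g -> (forall U, 0 < w U) ->
  (forall U, trl S g U = w U * g U) ->
  (forall i j U, `|U i j * g U| <= K) -> g = 0.
Proof.
move=> sS pS sg wp gE decay.
have le0 u : Cinf u -> (forall U, trl S u U = w U * u U) ->
    (forall i j U, `|U i j * u U| <= K) -> forall U, u U <= 0.
  move=> su uE ud U; rewrite leNgt; apply/negP => up.
  have [x xmax] := decay_max (Cinf_continuous su) up ud.
  have := trl_at_max sS pS su xmax; rewrite uE pmulr_rle0// => /(le_trans (xmax U)).
  by rewrite leNgt up.
(* The equation is linear and the decay bound is even in [g], so the one-sided estimate also applies
   to [- g]. *)
apply/funext => U; apply/eqP; rewrite eq_le le0//= -oppr_le0.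
have -> : - g U = (-1 *: g) U by rewrite scaleN1r.
apply: le0; first exact: CinfZ.
- by move=> y; rewrite (smlinZ (smlin_trl _ _))// !scaleN1r /= mulrN -gE.
- by move=> i j y; rewrite scaleN1r /= mulrN normrN.
Qed.

End MaximumPrinciple.

(** * Growth solutions are polynomials *)

(* The second derivative of [h * gs] contracted with [S], the values at a point
   being indeterminates. *)
Lemma contract_expand (R : comPzRingType) (m : nat) (S M H : 'I_m -> 'I_m -> R)
    (L D : 'I_m -> R) (x c g : R) :
  \sum_a \sum_b S a b * ((H a b + c * (M b a * x) + c * (L b * D a) +
    c * (L a * D b) + c ^+ 2 * (L a * L b * x)) * g) =
  (\sum_a \sum_b S a b * H a b + c * x * (\sum_a \sum_b S a b * M b a) +
   c * (\sum_a (\sum_b S a b * L b) * D a) +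
   c * (\sum_b (\sum_a S a b * L a) * D b) +
   c ^+ 2 * x * (\sum_a (\sum_b S a b * L b) * L a)) * g.
Proof.
have -> : \sum_b (\sum_a S a b * L a) * D b = \sum_a \sum_b S a b * L a * D b.
  by rewrite exchange_big; apply: eq_bigr => b _; rewrite mulr_suml.
rewrite !mulr_sumr -!big_split /= mulr_suml; apply: eq_bigr => a _.
rewrite !mulr_suml !mulr_sumr -!big_split /= mulr_suml; apply: eq_bigr => b _.
ring.
Qed.

(** The sum over the columns; the constant [N] coming from each of them is multiplied by [n]. *)
Lemma contract_sum (R : comPzRingType) (n : nat) (l e t : 'I_n -> R)
    (p q s N x g : R) :
  \sum_j (l j - p * e j - q * N * x + s * x * t j) * g =
  (\sum_j l j - p * \sum_j e j - q * (N * n%:R) * x + s * (\sum_j t j) * x) * g.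
Proof.
rewrite -mulr_suml; congr (_ * _).
rewrite !big_split /= !sumrN -!mulr_sumr sumr_const card_ord -mulr_natr; ring.
Qed.

(** * Conjugation of the Laplacian by the Gaussian *)

Section Gaussian.
Variables (R : realType) (m n : nat) (M : 'M[R]_m).
Local Notation X := 'M[R]_(m, n).
Local Notation idx := ('I_m * 'I_n)%type.
Implicit Types (u g h p : X -> R) (U : X) (k : idx).
Hypothesis Msym : M^T = M.

Lemma scale_funE c u U : (c *: u) U = c * u U.
Proof. by []. Qed.

(** This is tr(U^T M U), written with coordinate functions so that the product rule applies. [lcrd]
    below gives the entries of M U, half its gradient. *)
Definition qf : X -> R :=
  \sum_(j < n) \sum_a \sum_b M a b *: (crd a j * crd b j).

Definition lcrd k : X -> R := \sum_b M k.1 b *: crd b k.2.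

Definition gs (c : R) : X -> R := fun U => expR (c * qf U).

Lemma qfE U : qf U = \sum_j bform M (U ^~ j) (U ^~ j).
Proof.
rewrite /qf fct_sumE; apply: eq_bigr => j _; rewrite fct_sumE.
by apply: eq_bigr => a _; rewrite fct_sumE.
Qed.

Lemma tr_qf U : \tr (U^T *m M *m U) = qf U.
Proof.
rewrite qfE; apply: eq_bigr => j _; rewrite -mulmxA mxE; apply: eq_bigr => a _.
rewrite !mxE mulr_sumr; apply: eq_bigr => b _; ring.
Qed.

Lemma lcrdE k U : lcrd k U = (M *m U) k.1 k.2.
Proof. by rewrite /lcrd fct_sumE mxE. Qed.

Lemma polyR_qf : polyR qf.
Proof.
apply: polyR_sum => j; apply: polyR_sum => a; apply: polyR_sum => b.
by apply: polyRZ; apply: polyRM; exact: polyR_crd.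
Qed.

Lemma polyR_lcrd k : polyR (lcrd k).
Proof. by apply: polyR_sum => b; apply: polyRZ; exact: polyR_crd. Qed.

Lemma dpar_lcrd k l : dpar k (lcrd l) = cst (M l.1 k.1 * (k.2 == l.2)%:R).
Proof.
rewrite dpar_sum; last by move=> b; exact/CinfZ/Cinf_crd.
apply/funext => U; rewrite fct_sumE (bigD1 k.1)//= big1 ?addr0.
  rewrite dparZ ?dpar_crd; last exact: Cinf_crd.
  by rewrite scale_funE; case: k => a b; rewrite xpair_eqE eqxx.
move=> b; rewrite eq_sym => /negbTE bk; rewrite dparZ; last exact: Cinf_crd.
rewrite dpar_crd scale_funE; case: k bk => a j /= bk.
by rewrite xpair_eqE bk mulr0.
Qed.

Lemma dpar_qf k : dpar k qf = 2 *: lcrd k.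
Proof.
have sj (j : 'I_n) a b : Cinf (M a b *: (crd a j * crd b j) : X -> R).
  by apply: CinfZ; apply: CinfM; exact: Cinf_crd.
have scrd a j : Cinf (@crd R m n a j) by exact: Cinf_crd.
apply/funext => U; rewrite dpar_sum; last first.
  by move=> j; apply: Cinf_sum => a; exact: Cinf_sum.
rewrite fct_sumE scale_funE /lcrd fct_sumE.
have step (j : 'I_n) : dpar k (\sum_a \sum_b M a b *: (crd a j * crd b j)) U =
    (k.2 == j)%:R * (2 * \sum_b M k.1 b * U b k.2).
  have -> : dpar k (\sum_a \sum_b M a b *: (crd a j * crd b j)) U =
      \sum_a \sum_b M a b * ((k == (a, j))%:R * U b j + U a j * (k == (b, j))%:R).
    rewrite dpar_sum; last by move=> a; exact: Cinf_sum.
    rewrite fct_sumE; apply: eq_bigr => a _; rewrite dpar_sum// fct_sumE.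
    apply: eq_bigr => b _; rewrite dparZ; last exact: CinfM.
    by rewrite dparM// !dpar_crd.
  have [kj|kj] := eqVneq k.2 j; last first.
    rewrite mul0r big1// => a _; rewrite big1// => b _.
    by case: k kj => c d /= kj; rewrite !xpair_eqE (negbTE kj) !andbF
      mul0r mulr0 addr0 mulr0.
  rewrite mul1r mulr_natl mulr2n.
  rewrite (eq_bigr (fun a => \sum_b (k.1 == a)%:R * (M a b * U b j) +
     \sum_b (k.1 == b)%:R * (M a b * U a j))); last first.
    move=> a _; rewrite -big_split; apply: eq_bigr => b _ /=.
    by case: k kj => c d /= ->; rewrite !xpair_eqE !eqxx !andbT; ring.
  rewrite big_split /= [X in _ + X]exchange_big /=; congr (_ + _).
    rewrite (bigD1 k.1)//= eqxx [X in _ + X]big1 ?addr0.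
      by apply: eq_bigr => b _; rewrite mul1r kj.
    by move=> a; rewrite eq_sym => /negbTE ->; rewrite big1// => b _; rewrite mul0r.
  rewrite (bigD1 k.1)//= eqxx [X in _ + X]big1 ?addr0.
    by apply: eq_bigr => b _; rewrite mul1r kj -{1}Msym mxE.
  by move=> a; rewrite eq_sym => /negbTE ->; rewrite big1// => b _; rewrite mul0r.
rewrite (eq_bigr _ (fun j _ => step j)) (bigD1 k.2)//= eqxx mul1r.
rewrite [X in _ + X]big1 ?addr0//.
by move=> j; rewrite eq_sym => /negbTE ->; rewrite mul0r.
Qed.

Lemma is_derive_gs c k U :
  is_derive U (delta_mx k.1 k.2) (gs c) ((2 * c) * lcrd k U * gs c U).
Proof.
have dq : is_derive U (delta_mx k.1 k.2) (c *: qf) (c * (2 * lcrd k U)).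
  have := derivableP (Cinf_derivable (k := k) (x := U)
    (CinfZ c (polyR_Cinf polyR_qf))).
  by rewrite -/(dpar k (c *: qf) U) dparZ ?dpar_qf//; exact: polyR_Cinf polyR_qf.
have := is_derive_compR (is_derive_expR ((c *: qf) U)) dq.
by rewrite /gs -[(c *: qf) U]/(c * qf U); congr is_derive; ring.
Qed.

Lemma dpar_gs c k : dpar k (gs c) = (2 * c) *: (lcrd k * gs c).
Proof.
apply/funext => U; rewrite /dpar (is_derive_val (is_derive_gs c k U)).
by rewrite -mulrA.
Qed.

Lemma Cinf_gs c : Cinf (gs c).
Proof.
have cg : continuous (gs c).
  move=> U; apply: (@continuous_comp _ _ _ (c *: qf) expR).
    exact: (Cinf_continuous (CinfZ c (polyR_Cinf polyR_qf))).
  exact: continuous_expR.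
elim=> [|d IH]; first exact: cg.
split; [exact: cg|move=> k; split].
  by move=> U; exact: is_derive_derivable (is_derive_gs c k U).
rewrite dpar_gs; apply: (Ck_mul (u := cst (2 * c))); first exact: Cinf_cst.
by apply: Ck_mul => //; exact: polyR_Cinf (polyR_lcrd k) d.
Qed.

Lemma dpar_mul_gs c k h : Cinf h ->
  dpar k (h * gs c) = (dpar k h + (2 * c) *: (lcrd k * h)) * gs c.
Proof.
move=> sh; rewrite dparM//; last exact: Cinf_gs.
rewrite dpar_gs; apply/funext => U.
change (dpar k h U * gs c U + h U * (2 * c * (lcrd k U * gs c U)) =
  (dpar k h U + 2 * c * (lcrd k U * h U)) * gs c U).
ring.
Qed.

Hypothesis Mpd : forall x : 'cV[R]_m, x != 0 -> 0 < (x^T *m M *m x) 0 0.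
Let S := invmx M.

Lemma posdef_unit : M \in unitmx.
Proof.
rewrite unitmxE unitfE; apply/negP => /det0P [v v0 vM].
have /Mpd : v^T != 0 by rewrite trmx_eq0.
by rewrite trmxK vM mul0mx mxE ltxx.
Qed.

Lemma bform_mx (T : 'M[R]_m) (x : 'I_m -> R) :
  bform T x x = ((\col_a x a)^T *m T *m (\col_a x a)) 0 0.
Proof.
rewrite -mulmxA mxE; apply: eq_bigr => a _; rewrite !mxE mulr_sumr.
by apply: eq_bigr => b _; rewrite mxE; ring.
Qed.

Lemma posdef_psd : psd M.
Proof.
move=> x; rewrite bform_mx.
have [->|/Mpd/ltW//] := eqVneq (\col_a x a) 0; by rewrite mulmx0 mxE.
Qed.

Lemma sym_invmx : S^T = S.
Proof. by rewrite /S trmx_inv Msym. Qed.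

Lemma psd_invmx : psd S.
Proof.
move=> x; rewrite bform_mx; set y := \col_a x a.
have E : y^T *m S *m y = (S *m y)^T *m M *m (S *m y).
  rewrite trmx_mul sym_invmx -!mulmxA; congr (_ *m _); congr (_ *m _).
  by rewrite mulmxA mulmxV ?posdef_unit// mul1mx.
rewrite E; have -> : S *m y = \col_a ((S *m y) a 0).
  by apply/matrixP => a b; rewrite !mxE ord1.
by rewrite -bform_mx; exact: posdef_psd.
Qed.

Lemma qf_ge0 U : 0 <= qf U.
Proof. by rewrite qfE; apply: sumr_ge0 => j _; exact: posdef_psd. Qed.

(** Since [S] inverts [M], the coordinate [U i j] is the product of row [i] of [S] with column [j]
    of [U] for the form [M], and Cauchy-Schwarz applies. Summing over [i] makes the constant
    uniform. *)
Lemma coord_qf : exists2 K, 0 <= K & forall i j U, U i j ^+ 2 <= K * qf U.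
Proof.
exists (\sum_i bform M (S i) (S i)) => [|i j U].
  by apply: sumr_ge0 => i _; exact: posdef_psd.
have -> : U i j = bform M (S i) (U ^~ j).
  have := mulKmx posdef_unit U; rewrite -/S => /matrixP/(_ i j) => <-.
  rewrite mxE; apply: eq_bigr => a _; rewrite mxE mulr_sumr.
  by apply: eq_bigr => b _ /=; ring.
rewrite (le_trans (psd_cauchy _ _ Msym posdef_psd))// ler_pM ?posdef_psd//.
  by rewrite (bigD1 i)//= lerDl; apply: sumr_ge0 => k _; exact: posdef_psd.
by rewrite qfE (bigD1 j)//= lerDl; apply: sumr_ge0 => k _; exact: posdef_psd.
Qed.

(** Contraction with [S] undoes the [M] in the gradient of the Gaussian: both cross terms become
    Euler operators, the Hessian of the exponent gives tr(S M) = m per column, and the squared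
    gradient gives back [qf]. *)
Lemma trl_mul_gs h U : Cinf h ->
  trl S (h * gs (- pi)) U =
  (trl S h U - 4 * pi * (\sum_i eu i i h) U - 2 * pi * (m * n)%:R * h U +
   4 * pi ^+ 2 * qf U * h U) * gs (- pi) U.
Proof.
move=> sh; pose c := (2 * - pi : R).
have sp p : polyR p -> Cinf p by exact: polyR_Cinf.
have sl k : Cinf (lcrd k) by exact/sp/polyR_lcrd.
have sdh k : Cinf (dpar k h) by exact: Cinf_dpar.
have slh k : Cinf (lcrd k * h) by exact: CinfM.
have second k l : dpar k (dpar l (h * gs (- pi))) U =
    (dpar k (dpar l h) U + c * (M l.1 k.1 * (k.2 == l.2)%:R * h U) +
     c * (lcrd l U * dpar k h U) + c * (lcrd k U * dpar l h U) +
     c ^+ 2 * (lcrd k U * lcrd l U * h U)) * gs (- pi) U.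
  rewrite dpar_mul_gs// dpar_mul_gs; last exact/CinfD/CinfZ.
  rewrite dparD//; last exact: CinfZ.
  rewrite dparZ// dparM// dpar_lcrd -/c.
  change ((dpar k (dpar l h) U + c * (M l.1 k.1 * (k.2 == l.2)%:R * h U +
     lcrd l U * dpar k h U) + c * (lcrd k U * (dpar l h U + c * (lcrd l U * h U)))) *
     gs (- pi) U = (dpar k (dpar l h) U + c * (M l.1 k.1 * (k.2 == l.2)%:R * h U) +
     c * (lcrd l U * dpar k h U) + c * (lcrd k U * dpar l h U) +
     c ^+ 2 * (lcrd k U * lcrd l U * h U)) * gs (- pi) U).
  by ring.
have SL a j : \sum_b S a b * lcrd (b, j) U = U a j.
  rewrite -[RHS](congr1 (fun A : X => A a j) (mulKmx posdef_unit U)) mxE.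
  by apply: eq_bigr => b _; rewrite lcrdE.
have SL' b j : \sum_a S a b * lcrd (a, j) U = U b j.
  by rewrite -SL; apply: eq_bigr => a _; rewrite -{1}sym_invmx mxE.
have SM : \sum_a \sum_b S a b * M b a = m%:R.
  rewrite -(mxtrace1 R m) -(mulVmx posdef_unit); apply: eq_bigr => a _.
  by rewrite mxE.
have qL : qf U = \sum_j \sum_a U a j * lcrd (a, j) U.
  rewrite qfE; apply: eq_bigr => j _; apply: eq_bigr => a _.
  rewrite lcrdE mxE mulr_sumr; apply: eq_bigr => b _ /=; ring.
rewrite 2!trlE fct_sumE.
have col (j : 'I_n) : lap S j j (h * gs (- pi)) U =
    (lap S j j h U - 4 * pi * eu j j h U - 2 * pi * m%:R * h U +
     4 * pi ^+ 2 * h U * \sum_a U a j * lcrd (a, j) U) * gs (- pi) U.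
  rewrite !lapE.
  have second' a b : dpar (a, j) (dpar (b, j) (h * gs (- pi))) U =
     (dpar (a, j) (dpar (b, j) h) U + c * (M b a * h U) +
      c * (lcrd (b, j) U * dpar (a, j) h U) +
      c * (lcrd (a, j) U * dpar (b, j) h U) +
      c ^+ 2 * (lcrd (a, j) U * lcrd (b, j) U * h U)) * gs (- pi) U.
    by rewrite second /= eqxx mulr1.
  apply: (etrans (eq_bigr _ (fun a _ => eq_bigr _ (fun b _ =>
    congr1 (fun z => S a b * z) (second' a b))))).
  apply: etrans (contract_expand S M (fun a b => dpar (a, j) (dpar (b, j) h) U)
    (fun a => lcrd (a, j) U) (fun a => dpar (a, j) h U) _ _ _) _.
  have e1 : \sum_a (\sum_b S a b * lcrd (b, j) U) * dpar (a, j) h U = eu j j h U.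
    by rewrite euE; apply: eq_bigr => a _; rewrite SL.
  have e2 : \sum_b (\sum_a S a b * lcrd (a, j) U) * dpar (b, j) h U = eu j j h U.
    by rewrite euE; apply: eq_bigr => a _; rewrite SL'.
  have e3 : \sum_a (\sum_b S a b * lcrd (b, j) U) * lcrd (a, j) U =
      \sum_a U a j * lcrd (a, j) U.
    by apply: eq_bigr => a _; rewrite SL.
  by rewrite SM e1 e2 e3 /c; ring.
apply: (etrans (eq_bigr _ (fun j _ => col j))); rewrite qL natrM.
exact: (contract_sum (fun j => lap S j j h U) (fun j => eu j j h U)
  (fun j => \sum_a U a j * lcrd (a, j) U)).
Qed.

Lemma gs_gt0 c U : 0 < gs c U.
Proof. exact: expR_gt0. Qed.

(** The equation turns [trl_mul_gs] into multiplication by [w]. Its value at [qf = 0] is 2 pi (- m n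
    - 2 kappa), which explains the threshold on [kappa]; [qf >= 0] only increases it. *)
Lemma oscillator_vanish h (kappa K : R) : Cinf h ->
  (forall U, (\sum_i eu i i h) U - (4 * pi)^-1 * trl S h U = kappa * h U) ->
  2 * kappa < - (m * n)%:R ->
  (forall i j U, `|U i j * (h * gs (- pi)) U| <= K) -> h = 0.
Proof.
have key (p a b x q N : R) : p != 0 -> a - (4 * p)^-1 * b = kappa * x ->
    b - 4 * p * a - 2 * p * N * x + 4 * p ^+ 2 * q * x =
    (- (4 * p * kappa) - 2 * p * N + 4 * p ^+ 2 * q) * x.
  move=> p0 E; have -> : b = 4 * p * (a - kappa * x) by rewrite -E; field.
  ring.
move=> sh hE kneg decay; have pi0 : 0 < (pi : R) by exact: pi_gt0.
have g0 : h * gs (- pi) = 0.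
  pose w U := - (4 * pi * kappa) - 2 * pi * (m * n)%:R + 4 * pi ^+ 2 * qf U.
  apply: (max_principle (S := S) (w := w) (K := K)) => //.
  - exact: sym_invmx.
  - exact: psd_invmx.
  - by apply: CinfM => //; exact: Cinf_gs.
  - move=> U; rewrite /w ltr_wpDr//.
      by rewrite mulr_ge0 ?qf_ge0// mulr_ge0// sqr_ge0.
    have -> : - (4 * pi * kappa) - 2 * pi * (m * n)%:R =
        2 * pi * (- (m * n)%:R - 2 * kappa) by ring.
    by rewrite mulr_gt0 ?mulr_gt0// subr_gt0.
  - move=> U; rewrite trl_mul_gs// -[(h * _) U]/(h U * _) mulrA; congr (_ * _).
    exact: key (lt0r_neq0 pi0) (hE U).
apply/funext => U; have /eqP := congr1 (fun f => f U) g0.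
rewrite -[(h * _) U]/(h U * _) mulf_eq0 => /orP[/eqP//|].
by rewrite gt_eqF// gs_gt0.
Qed.

End Gaussian.

(** * Rapid decay, and the descent to derivatives that vanish *)

Section RapidDecay.
Variables (R : realType) (m n : nat).
Local Notation X := 'M[R]_(m, n).
Local Notation idx := ('I_m * 'I_n)%type.
Implicit Types (u g h p : X -> R) (U : X) (k : idx) (b : 'M[nat]_(m, n)).

Definition mono b U : R := \prod_i \prod_j U i j ^+ b i j.

Definition decaying g : Prop := forall b, exists K, forall U, `|mono b U * g U| <= K.

(** The decay half of [schwartz] for a real function, graded by the order of the derivatives so that
    products are handled by induction. *)
Fixpoint rapid (d : nat) g : Prop :=
  decaying g /\ (if d is e.+1 then forall k, rapid e (dpar k g) else True).

Lemma rapid_decaying d g : rapid d g -> decaying g.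
Proof. by case: d => [|d] []. Qed.

Lemma rapidS d g : rapid d.+1 g -> rapid d g.
Proof.
elim: d g => [|d IH] g; first by case.
by move=> [dg rg]; split=> // k; apply: IH; exact: rg.
Qed.

Lemma rapidD d g h : Cinf g -> Cinf h -> rapid d g -> rapid d h -> rapid d (g + h).
Proof.
elim: d g h => [|d IH] g h sg sh [dg rg] [dh rh].
all: have dgh : decaying (g + h) by move=> b; have [K KP] := dg b;
  have [K' KP'] := dh b; exists (K + K') => U;
  rewrite -[(g + h) U]/(g U + h U) mulrDr (le_trans (ler_normD _ _))// lerD.
- by split.
- split=> // k; rewrite dparD//; apply: IH; [exact: Cinf_dpar|exact: Cinf_dpar| |].
    exact: rg.
  exact: rh.
Qed.

Lemma rapidZ d c g : Cinf g -> rapid d g -> rapid d (c *: g).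
Proof.
elim: d g => [|d IH] g sg [dg rg].
all: have dc : decaying (c *: g) by move=> b; have [K KP] := dg b;
  exists (`|c| * K) => U; rewrite scale_funE mulrCA normrM ler_wpM2l.
- by split.
- by split=> // k; rewrite dparZ//; apply: IH; [exact: Cinf_dpar|exact: rg].
Qed.

Lemma mono_crd b i j U :
  mono b U * U i j = mono (\matrix_(a, l) (b a l + ((a, l) == (i, j)))%N) U.
Proof.
rewrite /mono !pair_bigA /= (bigD1 (i, j))//= [RHS](bigD1 (i, j))//=.
rewrite mxE eqxx addn1 exprSr mulrAC; congr (_ * _).
apply: eq_bigr => -[a l] /negbTE ne; by rewrite mxE ne addn0.
Qed.

Lemma rapid_crd d i j g : Cinf g -> rapid d g -> rapid d (crd i j * g).
Proof.
have dcrd f : decaying f -> decaying (crd i j * f).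
  move=> df b; have [K KP] := df (\matrix_(a, l) (b a l + ((a, l) == (i, j)))%N).
  by exists K => U; rewrite -[(_ * f) U]/(U i j * f U) mulrA mono_crd.
elim: d g => [|d IH] g sg rg.
  by case: rg => dg _; split=> //; exact: dcrd.
have rg' := rapidS rg; case: rg => dg rg; split; first exact: dcrd.
move=> k; rewrite dparM//; last exact: Cinf_crd.
rewrite dpar_crd; apply: rapidD.
- by apply: CinfM => //; exact: Cinf_cst.
- by apply: CinfM; [exact: Cinf_crd|exact: Cinf_dpar].
- by rewrite -[cst _ * _]/(_ *: g); exact: rapidZ.
- by apply: IH; [exact: Cinf_dpar|exact: rg].
Qed.

Lemma rapid_polyR d p g : polyR p -> Cinf g -> rapid d g -> rapid d (p * g).
Proof.
move=> pp; elim: pp g => {p} [c|i j|u v pu IHu pv IHv|u v pu IHu pv IHv] g sg rg.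
- by rewrite -[cst _ * _]/(_ *: g); exact: rapidZ.
- exact: rapid_crd.
- have [su sv] := (polyR_Cinf pu, polyR_Cinf pv).
  by rewrite mulrDl; apply: rapidD; [exact: CinfM..|exact: IHu|exact: IHv].
- rewrite -mulrA; apply: IHu; last exact: IHv.
  by apply: CinfM => //; exact: polyR_Cinf.
Qed.

Variable M : 'M[R]_m.
Hypothesis Msym : M^T = M.
Hypothesis Mpd : forall x : 'cV[R]_m, x != 0 -> 0 < (x^T *m M *m x) 0 0.
Local Notation S := (invmx M).
Local Notation gauss1 := (gs M (- pi)).

(** Measuring growth by [1 + qf] reduces the comparison with the Gaussian to a one-variable
    inequality; coordinates are covered by |t| <= 1 + t^2 and [coord_qf]. *)
Lemma polyR_bound p : polyR p ->
  exists2 C, 0 <= C & exists N, forall U, `|p U| <= C * (1 + qf M U) ^+ N.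
Proof.
have q1 U : 1 <= 1 + qf M U by rewrite lerDl; exact: qf_ge0.
have qX U N : 0 <= (1 + qf M U) ^+ N.
  by rewrite exprn_ge0// (le_trans ler01).
elim=> {p} [c|i j|u v _ [C C0 [N uN]] _ [D D0 [N' vN]]|
    u v _ [C C0 [N uN]] _ [D D0 [N' vN]]].
- by exists `|c| => //; exists 0%N => U; rewrite expr0 mulr1.
- have [K K0 KP] := coord_qf n Msym Mpd.
  exists (1 + K); first by rewrite addr_ge0.
  exists 1%N => U; rewrite expr1 /crd.
  have t2 : `|U i j| <= 1 + U i j ^+ 2.
    rewrite -real_normK ?num_real//.
    have [U1|U1] := leP `|U i j| 1; first by rewrite (le_trans U1)// lerDl sqr_ge0.
    by rewrite (@le_trans _ _ (`|U i j| ^+ 2)) ?lerDr// expr2 ler_peMl// ltW.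
  rewrite (le_trans t2)// mulrDl mul1r lerD ?q1//.
  by rewrite (le_trans (KP i j U))// ler_wpM2l// lerDr.
- exists (C + D); first exact: addr_ge0.
  exists (maxn N N') => U; rewrite (le_trans (ler_normD _ _))// mulrDl lerD//.
    by rewrite (le_trans (uN U))// ler_wpM2l// ler_weXn2l// leq_maxl.
  by rewrite (le_trans (vN U))// ler_wpM2l// ler_weXn2l// leq_maxr.
- exists (C * D); first exact: mulr_ge0.
  by exists (N + N')%N => U; rewrite normrM exprD mulrACA ler_pM.
Qed.

(** Write exp(pi t) as exp(s)^(N+1) with s = pi t / (N+1). Then (N+1) exp(s) >= (N+1)(1 + s) = N + 1
    + pi t >= 1 + t. Using [N.+1] avoids a division by zero. *)
Lemma expR_poly_bound N (t : R) : 0 <= t ->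
  (1 + t) ^+ N * expR (- pi * t) <= N.+1%:R ^+ N.+1.
Proof.
move=> t0; have pi1 : (1 : R) <= pi by rewrite (le_trans _ (pi_ge2 R))// ler1n.
have N0 : (0 : R) < N.+1%:R by rewrite ltr0n.
have t1 : 1 <= 1 + t by rewrite lerDl.
pose s := pi * t / N.+1%:R.
have -> : expR (- pi * t) = (expR s ^+ N.+1)^-1.
  by rewrite -expRM_natl /s mulrCA divff ?gt_eqF// mulr1 mulNr expRN.
rewrite ler_pdivrMr ?exprn_gt0 ?expR_gt0// -exprMn.
apply: (@le_trans _ _ ((1 + t) ^+ N.+1)); first by rewrite ler_weXn2l.
apply: lerXn2r; rewrite ?nnegrE; first exact: le_trans ler01 t1.
  by rewrite mulr_ge0 ?expR_ge0 ?ltW.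
rewrite (@le_trans _ _ (N.+1%:R * (1 + s)))//; last first.
  by rewrite ler_wpM2l// expR_ge1Dx.
rewrite mulrDr mulr1 lerD ?ler1n//.
by rewrite /s mulrCA divff ?gt_eqF// mulr1 ler_peMl.
Qed.

Lemma polyR_gs_bounded p : polyR p -> exists K, forall U, `|p U * gauss1 U| <= K.
Proof.
move=> /polyR_bound [C C0 [N pN]]; exists (C * N.+1%:R ^+ N.+1) => U.
rewrite normrM (ger0_norm (ltW (gs_gt0 M _ U))).
rewrite (@le_trans _ _ (C * (1 + qf M U) ^+ N * gauss1 U))//.
  by rewrite ler_wpM2r// ltW// gs_gt0.
by rewrite -mulrA ler_wpM2l// expR_poly_bound// qf_ge0.
Qed.

Lemma polyR_mono b : polyR (mono b).
Proof.
have pX i j e : polyR ((crd i j : X -> R) ^+ e).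
  elim: e => [|e IH]; first by rewrite expr0; exact: polyR_cst.
  by rewrite exprS; apply: polyRM => //; exact: polyR_crd.
have pP I (s : seq I) (F : I -> X -> R) : (forall i, polyR (F i)) ->
    polyR (\prod_(i <- s) F i).
  by move=> pF; elim/big_ind: _ => //; [exact: polyR_cst|exact: polyRM].
have -> : mono b = \prod_i \prod_j (crd i j : X -> R) ^+ b i j.
  apply/funext => U; rewrite /mono fct_prodE; apply: eq_bigr => i _.
  rewrite fct_prodE; apply: eq_bigr => j _.
  by elim: (b i j) => [//|e IH]; rewrite !exprS IH.
by apply: (pP) => i; apply: (pP) => j.
Qed.

(** Polynomials times the Gaussian are stable under [dpar], so boundedness of all of them gives
    decay of all derivatives. This supplies the growth condition for the exhibited solutions. *)
Lemma polyR_gs_rapid d p : polyR p -> rapid d (p * gauss1).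
Proof.
elim: d p => [|d IH] p pp.
all: have dp : decaying (p * gauss1) by move=> b;
  have [K KP] := polyR_gs_bounded (polyRM (polyR_mono b) pp);
  exists K => U; rewrite mulrA; exact: KP.
- by split.
- split=> // k; rewrite dpar_mul_gs//; last exact: polyR_Cinf.
  apply: IH; apply: polyRD; first exact: polyR_dpar.
  by apply: polyRZ; apply: polyRM => //; exact: polyR_lcrd.
Qed.

Lemma solution_polyR u (kappa : R) : Cinf u ->
  (forall U, (\sum_i eu i i u) U - (4 * pi)^-1 * trl S u U = kappa * u U) ->
  (forall d, rapid d (u * gauss1)) -> polyR u.
Proof.
have key (a x t q ka : R) : a + x + (- q) * t = ka * x ->
    a - q * t = (ka - 1) * x.
  by move=> E; rewrite mulrBl -E; ring.
move=> su ue ru.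
(* Generalized over [ka]: a derivative lowers both [ka] and [d] by one and leaves [ka - d%:R]
   unchanged. *)
suff deg d v (ka : R) : Cinf v ->
    (forall U, (\sum_i eu i i v) U - (4 * pi)^-1 * trl S v U = ka * v U) ->
    (forall d, rapid d (v * gauss1)) -> 2 * (ka - d%:R) < - (m * n)%:R ->
    degle d v.
  pose B := 2 * kappa + (m * n)%:R.
  (* Any natural number above B / 2 would do; this one exceeds [B] itself. *)
  pose d := (Num.truncn `|B|).+1.
  have Bd : B < 2 * d%:R.
    rewrite (@lt_le_trans _ _ d%:R)//; last by rewrite ler_peMl// ler1n.
    by rewrite (le_lt_trans (ler_norm B))// truncnS_gt.
  apply: (degle_polyR (d := d)) => //; apply: (deg _ _ kappa) => //.
  by rewrite mulrBr ltrBlDr addrC ltrBrDr.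
elim: d v ka => [|d IH] v ka sv ve rv kad.
  rewrite subr0 in kad.
  (* The decay constants depend on the coordinate; the sum of their absolute values is a common
     one. *)
  have /(_ _)/cid/= Kex k : exists K, forall U, `|U k.1 k.2 * (v * gauss1) U| <= K.
    have [K KP] := rapid_decaying (rapid_crd k.1 k.2
      (CinfM sv (Cinf_gs n Msym (- pi))) (rv 0%N)) (const_mx 0%N).
    exists K => U; have := KP U; rewrite /mono big1 ?mul1r// => i _.
    by rewrite big1// => j _; rewrite mxE expr0.
  apply: (oscillator_vanish Msym Mpd (kappa := ka)
    (K := \sum_k `|sval (Kex k)|)) => // i j U.
  have := svalP (Kex (i, j)) U => /= h; rewrite (le_trans h)//.
  by rewrite (bigD1 (i, j))//= ler_wpDr ?ler_norm// sumr_ge0.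
move=> k; apply: (IH _ (ka - 1)).
- exact: Cinf_dpar.
- have eE : \sum_i eu i i v - (4 * pi)^-1 *: trl S v = ka *: v.
    by apply/funext => U; exact: ve.
  have seu i : Cinf (eu i i v) by exact: (smlin_Cinf (@smlin_eu R m n i i) sv).
  have st : Cinf (trl S v) by exact: (smlin_Cinf (@smlin_trl R m n S) sv).
  have := congr1 (dpar k) eE; rewrite dparZ// -scaleNr dparD; last 2 first.
  - exact: Cinf_sum.
  - exact: CinfZ.
  rewrite dparZ// dpar_trl// dpar_sum_eu// => E U.
  by apply: key; exact: (congr1 (fun f => f U) E).
- move=> e.
  (* Decay is known for derivatives of the product only; the product rule is solved for the term
     with the derivative of [v]. *)
  have -> : dpar k v * gauss1 =
      dpar k (v * gauss1) + (- (2 * - pi)) *: (lcrd M k * (v * gauss1)).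
    rewrite dpar_mul_gs//; apply/funext => U.
    change (dpar k v U * gauss1 U = (dpar k v U + 2 * - pi * (lcrd M k U * v U)) *
      gauss1 U + - (2 * - pi) * (lcrd M k U * (v U * gauss1 U))).
    ring.
  have sg : Cinf (v * gauss1) by apply: CinfM => //; exact: Cinf_gs.
  have sl : Cinf (lcrd M k : X -> R) by exact/polyR_Cinf/polyR_lcrd.
  apply: rapidD; [exact: Cinf_dpar|exact/CinfZ/CinfM| |].
    by case: (rv e.+1) => _; apply.
  apply: rapidZ; first exact: CinfM.
  by apply: rapid_polyR => //; exact: polyR_lcrd.
- by move: kad; rewrite -natr1; congr (_ < _); ring.
Qed.

(** With the coefficient [q] free, one statement serves both directions: the exponent [c] carries
    solutions from [q = 0] to the given system, and [- c] carries them back. *)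
Lemma eu_texp_eigen (T : 'M[R]_m) (c a q : R) K i j u : T^T = T -> Cinf u ->
  iter K (trl T) u = 0 -> eu i j u = a *: u + q *: lap T i j u ->
  eu i j (texp T c K.+1 u) =
  a *: texp T c K.+1 u + (q - 2 * c) *: lap T i j (texp T c K.+1 u).
Proof.
move=> sT su uK uE; have linE := @smlin_texp R m n T c K.+1.
have sl : Cinf (lap T i j u) := smlin_Cinf (@smlin_lap R m n T i j) su.
rewrite (eu_texp sT c i j su uK) uE (lap_texp T c K.+1 i j su).
rewrite (smlinD linE (CinfZ a su) (CinfZ q sl)) (smlinZ linE a su).
by rewrite (smlinZ linE q sl) scalerBl addrA.
Qed.

Lemma polyR_trl (T : 'M[R]_m) u : polyR u -> polyR (trl T u).
Proof.
move=> pu; apply: polyR_sum => i; apply: polyR_sum => a; apply: polyR_sum => b.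
by apply: polyRZ; apply: polyR_dpar; exact: polyR_dpar.
Qed.

Lemma polyR_texp (T : 'M[R]_m) c K u : polyR u -> polyR (texp T c K u).
Proof.
move=> pu; apply: polyR_sum => k; apply: polyRZ.
by elim: (nat_of_ord k) => //= e IH; exact: polyR_trl.
Qed.

End RapidDecay.

(** * Polynomial functions of complex matrices *)

Section PolynomialPaths.
Variable F : comNzRingType.
Implicit Types f g : F -> F.

(** The polynomial is left existential, so that composites along a path are handled by closure
    properties alone. *)
Definition polyin f : Prop := exists p : {poly F}, forall t, f t = p.[t].

Lemma polyin_cst c : polyin (fun=> c).
Proof. by exists c%:P => t; rewrite hornerC. Qed.

Lemma polyin_id : polyin id.
Proof. by exists 'X => t; rewrite hornerX. Qed.

Lemma polyinD f g : polyin f -> polyin g -> polyin (fun t => f t + g t).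
Proof. by move=> [p pE] [q qE]; exists (p + q) => t; rewrite hornerD pE qE. Qed.

Lemma polyinM f g : polyin f -> polyin g -> polyin (fun t => f t * g t).
Proof. by move=> [p pE] [q qE]; exists (p * q) => t; rewrite hornerM pE qE. Qed.

Lemma polyinX f k : polyin f -> polyin (fun t => f t ^+ k).
Proof. by move=> [p pE]; exists (p ^+ k) => t; rewrite horner_exp pE. Qed.

Lemma polyin_sum (I : Type) (s : seq I) (P : pred I) (f : I -> F -> F) :
  (forall i, polyin (f i)) -> polyin (fun t => \sum_(i <- s | P i) f i t).
Proof.
move=> /choice [p pE]; exists (\sum_(i <- s | P i) p i) => t.
by rewrite horner_sum; apply: eq_bigr => i _; exact: pE.
Qed.

Lemma polyin_prod (I : Type) (s : seq I) (P : pred I) (f : I -> F -> F) :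
  (forall i, polyin (f i)) -> polyin (fun t => \prod_(i <- s | P i) f i t).
Proof.
move=> /choice [p pE]; exists (\prod_(i <- s | P i) p i) => t.
by rewrite horner_prod; apply: eq_bigr => i _; exact: pE.
Qed.

Lemma polyin_det n (A : F -> 'M[F]_n) :
  (forall i j, polyin (fun t => A t i j)) -> polyin (fun t => \det (A t)).
Proof.
move=> pA; apply: polyin_sum => s; apply: polyinM; first exact: polyin_cst.
by apply: polyin_prod => i; exact: pA.
Qed.

Lemma polyin_mulmx m n p (A : F -> 'M[F]_(m, n)) (B : F -> 'M[F]_(n, p)) :
  (forall i j, polyin (fun t => A t i j)) ->
  (forall i j, polyin (fun t => B t i j)) ->
  forall i j, polyin (fun t => (A t *m B t) i j).
Proof.
move=> pA pB i j.
have [q qE] : polyin (fun t => \sum_k A t i k * B t k j).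
  by apply: polyin_sum => k; apply: polyinM.
by exists q => t; rewrite mxE qE.
Qed.

End PolynomialPaths.

(** In characteristic 0 the naturals are distinct, so [size p] of them are already too many roots.
    They are real points too, as the extension from real to complex arguments requires. *)
Lemma poly_nat_roots (F : numFieldType) (p : {poly F}) :
  (forall k : nat, p.[k%:R] = 0) -> p = 0.
Proof.
move=> p0; apply/eqP; apply/negPn/negP => pn0.
have := max_poly_roots (rs := [seq k%:R | k <- iota 0 (size p)]) pn0.
rewrite size_map size_iota ltnn => h; suff: false by []; apply: h.
  by apply/allP => x /mapP[k _ ->]; apply/eqP; exact: p0.
by rewrite map_inj_uniq ?iota_uniq//; exact: mulrIn (oner_neq0 _).
Qed.

Section RealExtension.
Variables (R : realType) (I : finType).
Local Notation C := R[i]%C.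
Implicit Types v : I -> C.

Definition upd v (k : I) (t : C) : I -> C := fun i => if i == k then t else v i.

(* One coordinate at a time, freeing it from the real line. *)
Lemma poly_real_ext (G : (I -> C) -> C) :
  (forall v k, polyin (fun t => G (upd v k t))) ->
  (forall x : I -> R, G (fun i => (x i)%:C%C) = 0) -> forall v, G v = 0.
Proof.
move=> pG G0.
suff ext (s : seq I) v :
    (forall i, i \notin s -> exists x : R, v i = x%:C%C) -> G v = 0.
  by move=> v; apply: (ext (enum I)) => i; rewrite mem_enum.
elim: s v => [|k s IH] v vs.
  have /choice [x xE] : forall i, exists x : R, v i = x%:C%C.
    by move=> i; exact: vs.
  by rewrite -(G0 x); congr G; apply/funext.
have [p pE] := pG v k.
have p0 : p = 0.
  apply: poly_nat_roots => d; rewrite -pE; apply: IH => i is'.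
  rewrite /upd; case: eqVneq => [_|ik]; first by exists d%:R; rewrite rmorph_nat.
  by apply: vs; rewrite inE negb_or ik.
have -> : v = upd v k (v k).
  by apply/funext => i; rewrite /upd; case: eqVneq => [->|].
by rewrite pE p0 horner0.
Qed.

Lemma polyin_upd v k i : polyin (fun t => upd v k t i).
Proof.
rewrite /upd; case: (i == k); first exact: polyin_id.
exact: polyin_cst.
Qed.

End RealExtension.

Section ComplexParts.
Variable R : realType.
Local Notation C := R[i]%C.
Implicit Types (x y : C).

Lemma ReD x y : complex.Re (x + y) = complex.Re x + complex.Re y.
Proof. by case: x y => [a b] [c d]. Qed.

Lemma ImD x y : complex.Im (x + y) = complex.Im x + complex.Im y.
Proof. by case: x y => [a b] [c d]. Qed.

Lemma ReM x y : complex.Re (x * y) =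
  complex.Re x * complex.Re y - complex.Im x * complex.Im y.
Proof. by case: x y => [a b] [c d]. Qed.

Lemma ImM x y : complex.Im (x * y) =
  complex.Re x * complex.Im y + complex.Im x * complex.Re y.
Proof. by case: x y => [a b] [c d]. Qed.

Lemma Re_sum (I : Type) (s : seq I) (P : pred I) (f : I -> C) :
  complex.Re (\sum_(i <- s | P i) f i) = \sum_(i <- s | P i) complex.Re (f i).
Proof. by apply: (big_morph _ ReD). Qed.

Lemma Im_sum (I : Type) (s : seq I) (P : pred I) (f : I -> C) :
  complex.Im (\sum_(i <- s | P i) f i) = \sum_(i <- s | P i) complex.Im (f i).
Proof. by apply: (big_morph _ ImD). Qed.

Lemma Re_scale (a : R) x : complex.Re (a%:C%C * x) = a * complex.Re x.
Proof. by rewrite ReM /= mul0r subr0. Qed.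

Lemma Im_scale (a : R) x : complex.Im (a%:C%C * x) = a * complex.Im x.
Proof. by rewrite ImM /= mul0r addr0. Qed.

Lemma complex_ext x y :
  complex.Re x = complex.Re y -> complex.Im x = complex.Im y -> x = y.
Proof. by case: x y => [a b] [c d] /= -> ->. Qed.

End ComplexParts.

Import (canonicals) mpoly.

(** * Complex polynomials and their restrictions to real matrices *)

Section PolynomialFunctions.
Variables (R : realType) (m n : nat).
Local Notation C := R[i]%C.
Implicit Types (P Q : 'M[C]_(m, n) -> C) (f : 'M[R]_(m, n) -> C).

Lemma poly_fun_cst c : poly_fun (fun _ : 'M[C]_(m, n) => c).
Proof. by exists (mpoly.mpolyC _ c) => U; rewrite mpoly.mevalC. Qed.

Lemma poly_fun_crd i j : poly_fun (fun U : 'M[C]_(m, n) => U i j).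
Proof.
exists (mpoly.mpolyX _ (mpoly.mnm1 (mxvec_index i j))) => U.
by rewrite mpoly.mevalXU mxvecE.
Qed.

Lemma poly_funD P Q : poly_fun P -> poly_fun Q -> poly_fun (fun U => P U + Q U).
Proof.
by move=> [p pE] [q qE]; exists (p + q) => U; rewrite mpoly.mevalD pE qE.
Qed.

Lemma poly_funM P Q : poly_fun P -> poly_fun Q -> poly_fun (fun U => P U * Q U).
Proof.
by move=> [p pE] [q qE]; exists (p * q) => U; rewrite mpoly.mevalM pE qE.
Qed.

Lemma polyin_poly_fun P (V : C -> 'M[C]_(m, n)) : poly_fun P ->
  (forall i j, polyin (fun t => V t i j)) -> polyin (fun t => P (V t)).
Proof.
move=> [p pE] pV.
have [q qE] : polyin (fun t => \sum_(b <- mpoly.msupp p) mpoly.mcoeff b p *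
    \prod_i mxvec (V t) 0 i ^+ mpoly.fun_of_multinom b i).
  apply: polyin_sum => b; apply: polyinM; first exact: polyin_cst.
  apply: polyin_prod => k; apply: polyinX; case/mxvec_indexP: k => i j.
  by have [q qE] := pV i j; exists q => t; rewrite mxvecE.
by exists q => t; rewrite pE mpoly.mevalE qE.
Qed.

Definition cpolyR f : Prop := polyR (ReF f) /\ polyR (ImF f).

Lemma cpolyR_cst c : cpolyR (fun=> c).
Proof. by split; exact: polyR_cst. Qed.

Lemma cpolyRD f g : cpolyR f -> cpolyR g -> cpolyR (fun U => f U + g U).
Proof.
move=> [rf cf] [rg cg]; split.
  have -> : ReF (fun U => f U + g U) = ReF f + ReF g.
    by apply/funext => U; rewrite /ReF ReD.
  exact: polyRD.
have -> : ImF (fun U => f U + g U) = ImF f + ImF g.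
  by apply/funext => U; rewrite /ImF ImD.
exact: polyRD.
Qed.

Lemma cpolyRM f g : cpolyR f -> cpolyR g -> cpolyR (fun U => f U * g U).
Proof.
move=> [rf cf] [rg cg]; split.
  have -> : ReF (fun U => f U * g U) = ReF f * ReF g + (-1) *: (ImF f * ImF g).
    by apply/funext => U; rewrite /ReF ReM scaleN1r.
  by apply: polyRD; [exact: polyRM|apply: polyRZ; exact: polyRM].
have -> : ImF (fun U => f U * g U) = ReF f * ImF g + ImF f * ReF g.
  by apply/funext => U; rewrite /ImF ImM.
by apply: polyRD; exact: polyRM.
Qed.

Lemma cpolyR_sum (I : Type) (s : seq I) (F : I -> 'M[R]_(m, n) -> C) :
  (forall i, cpolyR (F i)) -> cpolyR (fun U => \sum_(i <- s) F i U).
Proof.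
move=> pF; elim: s => [|i s IH].
  by under eq_fun do rewrite big_nil; exact: cpolyR_cst.
by under eq_fun do rewrite big_cons; exact: cpolyRD.
Qed.

Lemma cpolyR_prod (I : Type) (s : seq I) (F : I -> 'M[R]_(m, n) -> C) :
  (forall i, cpolyR (F i)) -> cpolyR (fun U => \prod_(i <- s) F i U).
Proof.
move=> pF; elim: s => [|i s IH].
  by under eq_fun do rewrite big_nil; exact: cpolyR_cst.
by under eq_fun do rewrite big_cons; exact: cpolyRM.
Qed.

Lemma cpolyRX f k : cpolyR f -> cpolyR (fun U => f U ^+ k).
Proof.
move=> pf; elim: k => [|k IH].
  by under eq_fun do rewrite expr0; exact: cpolyR_cst.
by under eq_fun do rewrite exprS; exact: cpolyRM.
Qed.

Lemma restr_real_cpolyR P : poly_fun P -> cpolyR (restr_real P).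
Proof.
move=> [p pE].
have -> : restr_real P = fun U => \sum_(b <- mpoly.msupp p) mpoly.mcoeff b p *
    \prod_i mxvec (map_mx (real_complex R) U) 0 i ^+ mpoly.fun_of_multinom b i.
  by apply/funext => U; rewrite /restr_real pE mpoly.mevalE.
apply: cpolyR_sum => b; apply: cpolyRM; first exact: cpolyR_cst.
apply: cpolyR_prod => k; apply: cpolyRX; case/mxvec_indexP: k => i j.
under eq_fun do rewrite mxvecE mxE.
by split; [exact: polyR_crd|exact: polyR_cst].
Qed.

Lemma polyR_extend u : polyR u ->
  exists2 P, poly_fun P & forall U : 'M[R]_(m, n), restr_real P U = (u U)%:C%C.
Proof.
elim=> {u} [c|i j|u v _ [P pP PE] _ [Q pQ QE]|u v _ [P pP PE] _ [Q pQ QE]].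
- by exists (fun=> c%:C%C) => //; exact: poly_fun_cst.
- exists (fun U => U i j); first exact: poly_fun_crd.
  by move=> U; rewrite /restr_real mxE.
- exists (fun U => P U + Q U); first exact: poly_funD.
  by move=> U; rewrite /restr_real [P _]PE [Q _]QE -rmorphD.
- exists (fun U => P U * Q U); first exact: poly_funM.
  by move=> U; rewrite /restr_real [P _]PE [Q _]QE -rmorphM.
Qed.

Lemma cpolyR_real_poly_fun f : cpolyR f -> real_poly_fun f.
Proof.
move=> [/polyR_extend [P pP PE] /polyR_extend [Q pQ QE]].
exists (fun U => P U + 'i%C * Q U).
  by apply: poly_funD => //; apply: poly_funM => //; exact: poly_fun_cst.
apply/funext => U; rewrite /restr_real [P _]PE [Q _]QE [LHS]complexE.
by [].
Qed.

(** Linear independence of the basis is given for functions of complex matrices; this carries it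
    over to their real restrictions. *)
Lemma restr_real_inj P Q : poly_fun P -> poly_fun Q ->
  restr_real P = restr_real Q -> P = Q.
Proof.
move=> pP pQ PQ; apply/funext => U; apply/eqP; rewrite -subr_eq0; apply/eqP.
pose G (v : 'I_m * 'I_n -> C) :=
  P (\matrix_(i, j) v (i, j)) - Q (\matrix_(i, j) v (i, j)).
have -> : P U - Q U = G (fun k => U k.1 k.2).
  by rewrite /G; congr (P _ - Q _); apply/matrixP => i j; rewrite mxE.
apply: poly_real_ext => [v k|x].
  have pM i j : polyin (fun t => (\matrix_(i < m, j < n) upd v k t (i, j)) i j).
    by have [q qE] := polyin_upd v k (i, j); exists q => t; rewrite mxE.
  rewrite /G; apply: polyinD; first exact: polyin_poly_fun.
  under eq_fun do rewrite -mulN1r.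
  by apply: polyinM; [exact: polyin_cst|exact: polyin_poly_fun].
have := congr1 (fun h => h (\matrix_(i, j) x (i, j))) PQ.
rewrite /restr_real /G => /eqP; rewrite -subr_eq0 => /eqP <-.
by congr (P _ - Q _); apply/matrixP => i j; rewrite !mxE.
Qed.

End PolynomialFunctions.

(** * Euler's equations and the determinant *)

Section JacobiFormula.
Variable F : comNzRingType.

Lemma deriv_prod_seq (I : eqType) (s : seq I) (f : I -> {poly F}) : uniq s ->
  (\prod_(i <- s) f i)^`() =
  \sum_(k <- s) \prod_(i <- s) (if i == k then (f i)^`() else f i).
Proof.
elim: s => [|i s IH]; first by rewrite !big_nil derivC.
rewrite cons_uniq => /andP[is' us]; rewrite !big_cons derivM eqxx IH//.
congr (_ * _ + _).
  apply: eq_big_seq => j js; case: eqVneq => // ji.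
  by rewrite -ji js in is'.
rewrite mulr_sumr; apply: eq_big_seq => k ks; rewrite big_cons.
by case: eqVneq => // ik; rewrite ik ks in is'.
Qed.

(** Jacobi's formula. The product rule differentiates one row at a time; expanding [B k] along its
    row [k] meets only cofactors of [A], because the other rows are unchanged. *)
Lemma deriv_det n (A : 'M[{poly F}]_n) :
  (\det A)^`() = \tr (\adj A *m map_mx (@deriv F) A).
Proof.
pose B k : 'M[{poly F}]_n := \matrix_(i, j) if i == k then (A i j)^`() else A i j.
transitivity (\sum_k \det (B k)).
  rewrite /determinant exchange_big /= raddf_sum; apply: eq_bigr => s _.
  rewrite -mulr_sumr /=.
  have -> (b : bool) (p : {poly F}) : ((-1) ^+ b * p)^`() = (-1) ^+ b * p^`().
    by case: b; rewrite ?mul1r// !mulN1r derivN.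
  congr (_ * _).
  rewrite (deriv_prod_seq _ (index_enum_uniq _)); apply: eq_bigr => k _.
  by apply: eq_bigr => i _; rewrite mxE.
rewrite mxtrace_mulC; apply: eq_bigr => k _.
rewrite mxE (expand_det_row _ k); apply: eq_bigr => j _; rewrite !mxE eqxx.
congr (_ * _); rewrite /cofactor; congr (_ * \det _).
apply/matrixP => a b; rewrite !mxE; case: eqVneq => // /eqP.
by rewrite eq_sym (negbTE (neq_lift _ _)).
Qed.

End JacobiFormula.

(* [p] and [q ^+ alpha] have the same logarithmic derivative: the lowest-order
   term of a nonzero difference would contradict this. *)
Lemma poly_log_deriv (F : numFieldType) (p q : {poly F}) (alpha : nat) :
  q.[0] = 1 -> q * p^`() = alpha%:R *: (p * q^`()) ->
  p = p.[0] *: q ^+ alpha.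
Proof.
have key1 (T : comPzRingType) (a b c x y : T) N :
    a * (b * (x * y) + c * (x *+ N)) = x * (a * (b * y + c *+ N)).
  by rewrite -[x *+ N]mulr_natl -[c *+ N]mulr_natl; ring.
have key2 (T : comPzRingType) (a b c x y : T) :
    a * (b * (x * y) * c) = x * (a * (b * c) * y).
  by ring.
move=> q0 pq; apply/eqP; rewrite -subr_eq0.
set r := _ - _.
have r0 : r.[0] = 0.
  by rewrite /r hornerD hornerN hornerZ horner_exp q0 expr1n mulr1 subrr.
have rq : q * r^`() = alpha%:R *: (r * q^`()).
  rewrite /r derivB derivZ deriv_exp mulrBr pq mulrBl scalerBr; congr (_ - _).
  case: (alpha) => [|k] /=; first by rewrite mulr0n scaler0 mulr0 scale0r.
  by rewrite exprS -mulr_natl -!mul_polyC rmorph_nat; ring.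
apply/negPn/negP => rn0.
have [k [s]] := multiplicity_XsubC r 0; rewrite rn0 /= subr0 => s0 rE.
case: k rE => [|k] rE.
  by move: s0; rewrite -[s]mulr1 -[1]/('X ^+ 0) -rE rootE r0 eqxx.
have : 'X ^+ k * (q * (s^`() * 'X + s *+ k.+1)) =
    'X ^+ k * (alpha%:R%:P * (s * q^`()) * 'X).
  have := rq; rewrite rE derivM derivXn /= -mul_polyC exprSr.
  by rewrite key1 key2.
move/(mulfI (expf_neq0 k (negbT (polyX_eq0 F))))/(congr1 (horner^~ 0)).
rewrite !hornerM hornerD hornerM hornerX hornerMn q0 !mulr0 add0r mul1r => /eqP.
by rewrite mulrn_eq0 /= => s00; rewrite rootE s00 in s0.
Qed.

Section EulerDeterminant.
Variables (R : realType) (m n : nat).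
Local Notation X := 'M[R]_(m, n).
Implicit Types (u : X -> R) (U : X).

Lemma polyin_polyR u (V : R -> X) : polyR u ->
  (forall i j, polyin (fun t => V t i j)) -> polyin (fun t => u (V t)).
Proof.
move=> pu pV; elim: pu => {u} [c|i j|u v _ pu _ pv|u v _ pu _ pv].
- exact: polyin_cst.
- exact: pV.
- exact: polyinD.
- exact: polyinM.
Qed.

(** The determinant along 1 + t W. Its value 1 at [t = 0] is the normalization required by
    [poly_log_deriv], and W = N - 1 reaches every [N] at [t = 1], singular or not. *)
Definition det_path (W : 'M[R]_n) : {poly R} :=
  \det (1%:M + 'X *: map_mx polyC W).

Lemma map_det_path (W : 'M[R]_n) (t : R) :
  map_mx (horner_eval t) (1%:M + 'X *: map_mx polyC W) = 1%:M + t *: W.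
Proof.
apply/matrixP => i j; rewrite [LHS]mxE /horner_eval !mxE.
by rewrite hornerD hornerM hornerX hornerC hornerMn hornerC.
Qed.

Lemma det_pathE W t : (det_path W).[t] = \det (1%:M + t *: W).
Proof.
by rewrite -map_det_path det_map_mx.
Qed.

Lemma deriv_det_pathE W t :
  (det_path W)^`().[t] = \tr (\adj (1%:M + t *: W) *m W).
Proof.
rewrite /det_path deriv_det -[LHS]/(horner_eval t _) -trace_map_mx map_mxM.
rewrite map_mx_adj map_det_path; congr (\tr (_ *m _)).
apply/matrixP => i j; rewrite !mxE /= /horner_eval derivD derivM derivX derivC.
by rewrite derivMn derivC mul0rn add0r mulr0 addr0 mul1r hornerC.
Qed.

Definition grad u U : X := \matrix_(a, l) dpar (a, l) u U.

Lemma dirD_grad u U (E : X) : dirD E u U = \tr (E^T *m grad u U).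
Proof.
transitivity (\sum_a \sum_l E a l * dpar (a, l) u U).
  by rewrite /dirD fct_sumE pair_bigA /=; apply: eq_bigr => -[a l] _.
rewrite exchange_big /=; apply: eq_bigr => l _; rewrite !mxE.
by apply: eq_bigr => a _; rewrite !mxE.
Qed.

Lemma eu_grad u U i j : eu i j u U = (U^T *m grad u U) i j.
Proof. by rewrite euE mxE; apply: eq_bigr => a _; rewrite !mxE. Qed.

Lemma is_derive_path u U (E : X) (t : R) : Cinf u ->
  is_derive t (1 : R) (fun s : R => u (U + s *: E)) (dirD E u (U + t *: E)).
Proof. by move=> su; apply: is_derive_line; exact: is_derive_dirD. Qed.

Lemma euler_det u (alpha : nat) : polyR u ->
  (forall i j U, eu i j u U = alpha%:R * (i == j)%:R * u U) ->
  forall (N : 'M[R]_n) U, u (U *m N) = \det N ^+ alpha * u U.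
Proof.
move=> pu ue N U; have su := polyR_Cinf pu.
pose W := N - 1%:M; pose q := det_path W; pose V (t : R) := U + t *: (U *m W).
have VE t : V t = U *m (1%:M + t *: W) by rewrite /V mulmxDr mulmx1 scalemxAr.
have [p pE] : polyin (fun t => u (V t)).
  apply: polyin_polyR => // i j; exists ((U i j)%:P + 'X * ((U *m W) i j)%:P) => t.
  by rewrite hornerD hornerM hornerX !hornerC /V [LHS]mxE; congr (_ + _); rewrite mxE.
have p'E t : p^`().[t] = dirD (U *m W) u (V t).
  have <- := is_derive_val (is_derive_path U (U *m W) t su).
  have -> : (fun s : R => u (U + s *: (U *m W))) = horner p by apply/funext.
  by rewrite derive_val.
have qp : q * p^`() = alpha%:R *: (p * q^`()).
  apply/eqP; rewrite -subr_eq0; apply/eqP/poly_nat_roots => k.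
  set t : R := k%:R; rewrite hornerD hornerN hornerZ !hornerM p'E dirD_grad -pE.
  rewrite det_pathE deriv_det_pathE; set Nt := 1%:M + t *: W.
  have euV : (V t)^T *m grad u (V t) = (alpha%:R * u (V t))%:M.
    apply/matrixP => i j; rewrite -eu_grad ue !mxE -mulr_natr; ring.
  (* The factor [\det Nt] is written as [Nt *m \adj Nt], and [Nt] is moved into [V t = U *m Nt].
     This produces the matrix of Euler operators at [V t] without inverting [Nt]. *)
  have -> : \det Nt * \tr ((U *m W)^T *m grad u (V t)) =
      \tr (W^T *m ((\adj Nt)^T *m ((V t)^T *m grad u (V t)))).
    rewrite VE -/Nt !trmx_mul !mulmxA -[W^T *m _ *m Nt^T]mulmxA.
    rewrite -(trmx_mul Nt (\adj Nt)).
    by rewrite mul_mx_adj tr_scalar_mx mul_mx_scalar -!scalemxAl mxtraceZ.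
  rewrite euV mul_mx_scalar -scalemxAr mxtraceZ -trmx_mul mxtrace_tr; ring.
have q0 : q.[0] = 1 by rewrite det_pathE scale0r addr0 det1.
have := congr1 (horner^~ 1) (poly_log_deriv q0 qp).
rewrite hornerZ horner_exp -!pE det_pathE /V scale0r addr0 !scale1r.
by rewrite /W mulmxBr mulmx1 !subrKC mulrC.
Qed.

(** Differentiation of the determinant law at [t = 0] along 1 + t W with [W = delta_mx i j], whose
    trace is the Kronecker symbol. *)
Lemma det_euler u (alpha : nat) : polyR u ->
  (forall (N : 'M[R]_n) U, u (U *m N) = \det N ^+ alpha * u U) ->
  forall i j U, eu i j u U = alpha%:R * (i == j)%:R * u U.
Proof.
move=> pu uN i j U; pose W : 'M[R]_n := delta_mx i j; pose q := det_path W.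
have su := polyR_Cinf pu.
have -> : eu i j u U = dirD (U *m W) u (U + 0 *: (U *m W)).
  rewrite scale0r addr0 dirD_grad eu_grad trmx_mul -mulmxA.
  rewrite trmx_delta mxtrace_mulC /mxtrace (bigD1 i)//= [X in _ + X]big1 ?addr0.
    rewrite !mxE (bigD1 j)//= [X in _ + X]big1 ?addr0; last first.
      by move=> k /negbTE kj; rewrite !mxE kj mulr0.
    by rewrite !mxE !eqxx mulr1.
  move=> k /negbTE ki; rewrite mxE big1// => l _.
  by rewrite !mxE ki andbF mulr0.
have <- := is_derive_val (is_derive_path U (U *m W) 0 su).
have -> : (fun s : R => u (U + s *: (U *m W))) = horner (q ^+ alpha * (u U)%:P).
  apply/funext => s; rewrite hornerM hornerC horner_exp det_pathE -uN.
  by rewrite mulmxDr mulmx1 scalemxAr.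
rewrite derive_val derivM derivC mulr0 addr0 hornerM hornerC deriv_exp hornerMn.
rewrite hornerM horner_exp deriv_det_pathE det_pathE scale0r addr0 det1 expr1n mulr1.
have -> : \adj (1%:M : 'M[R]_n) = 1%:M.
  by have := mul_adj_mx (1%:M : 'M[R]_n); rewrite mulmx1 det1.
have -> : \tr (1%:M *m W) = (i == j)%:R.
  rewrite mul1mx /mxtrace (bigD1 i)//= mxE eqxx big1 ?addr0// => k /negbTE ki.
  by rewrite mxE ki.
by rewrite -mulr_natl.
Qed.

End EulerDeterminant.

(** * The space of solutions *)

Lemma limn_series_eventually0 (R : realType) (a : nat -> R[i]%C) K :
  (forall k, (K <= k)%N -> a k = 0) ->
  limn (series a : nat -> R[i]%C^o) = \sum_(k < K) a k.
Proof.
move=> a0; apply: lim_near_cst => //; exists K => // N /= KN.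
rewrite /series /= (big_cat_nat _ KN)//= [X in _ + X]big_nat_cond.
rewrite [X in _ + X]big1 ?addr0 ?big_mkord// => k /andP[/andP[Kk _] _].
exact: a0.
Qed.

(** * Transfer of smoothness and decay to real and imaginary parts *)

Section RealAndImaginaryParts.
Variables (R : realType) (m n : nat).
Local Notation X := 'M[R]_(m, n).
Local Notation C := R[i]%C.
Local Notation idx := ('I_m * 'I_n)%type.
Implicit Types (f g : X -> C) (U : X) (s : seq idx).

Lemma fun_complex_ext f g : ReF f = ReF g -> ImF f = ImF g -> f = g.
Proof.
move=> rE iE; apply/funext => U; apply: complex_ext.
  exact: (congr1 (fun h => h U) rE).
exact: (congr1 (fun h => h U) iE).
Qed.

Lemma ReF_iter_pderiv s f :
  ReF (iter_pderiv s f) = foldr (@dpar R m n) (ReF f) s.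
Proof. by elim: s => // k s IH; rewrite /= -IH; case: k. Qed.

Lemma ImF_iter_pderiv s f :
  ImF (iter_pderiv s f) = foldr (@dpar R m n) (ImF f) s.
Proof. by elim: s => // k s IH; rewrite /= -IH; case: k. Qed.

Lemma iter_pderiv_rcons s k f :
  iter_pderiv (rcons s k) f = iter_pderiv s (pderiv k.1 k.2 f).
Proof. by rewrite /iter_pderiv foldr_rcons. Qed.

Lemma smooth_pderiv k f : smooth f -> smooth (pderiv k.1 k.2 f).
Proof. by move=> sf s; rewrite -iter_pderiv_rcons; exact: sf. Qed.

Lemma smooth_Cinf f : smooth f -> Cinf (ReF f) /\ Cinf (ImF f).
Proof.
move=> sf; suff h d : Ck d (ReF f) /\ Ck d (ImF f).
  by split=> d; have [] := h d.
elim: d f sf => [|d IH] f sf; first by have [] := sf [::].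
have [cr ci pd] := sf [::].
have IHk k := IH _ (smooth_pderiv k sf).
split; split=> //.
  by case=> i j; split=> [x|]; [exact: (pd i j x).1|exact: (IHk (i, j)).1].
by case=> i j; split=> [x|]; [exact: (pd i j x).2|exact: (IHk (i, j)).2].
Qed.

Lemma Cinf_foldr s (u : X -> R) : Cinf u -> Cinf (foldr (@dpar R m n) u s).
Proof. by move=> su; elim: s => //= k s IH; exact: Cinf_dpar. Qed.

Lemma Cinf_smooth f : Cinf (ReF f) -> Cinf (ImF f) -> smooth f.
Proof.
move=> sr si s; rewrite ReF_iter_pderiv ImF_iter_pderiv.
have [sr' si'] := (Cinf_foldr s sr, Cinf_foldr s si).
split; [exact: Cinf_continuous|exact: Cinf_continuous|].
move=> i j U; rewrite ReF_iter_pderiv ImF_iter_pderiv.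
by split; [exact: (Cinf_derivable (k := (i, j)) sr')|
  exact: (Cinf_derivable (k := (i, j)) si')].
Qed.

Lemma normc_ge_Im (z : C) : `|complex.Im z|%:C%C <= `|z|.
Proof. by rewrite normc_def lecR -sqrtr_sqr ler_wsqrtr// lerDr sqr_ge0. Qed.

Lemma normc_le_Re_Im (z : C) : `|z| <= (`|complex.Re z| + `|complex.Im z|)%:C%C.
Proof.
rewrite normc_def lecR -[leRHS]ger0_norm ?addr_ge0// -sqrtr_sqr ler_sqrt ?sqr_ge0//.
rewrite sqrrD !real_normK ?num_real// lerD2r lerDl.
by rewrite mulrn_wge0// mulr_ge0.
Qed.

Lemma schwartz_rapid f : schwartz f ->
  forall d, rapid d (ReF f) /\ rapid d (ImF f).
Proof.
move=> [sf df] d.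
have dec g : (forall b, exists K, forall U, `|(mono b U)%:C%C * g U| <= K%:C%C) ->
    decaying (ReF g) /\ decaying (ImF g).
  move=> dg; split=> b; have [K KP] := dg b; exists K => U.
    by rewrite -Re_scale -lecR (le_trans _ (KP U))// normc_ge_Re.
  by rewrite -Im_scale -lecR (le_trans _ (KP U))// normc_ge_Im.
have {}df : forall b s, exists K : R, forall U,
    `|(mono b U)%:C%C * iter_pderiv s f U| <= K%:C%C by exact: df.
elim: d f {sf} df dec => [|d IH] f df dec.
  by have [dr di] := dec f (fun b => df b [::]); split; split.
have [dr di] := dec f (fun b => df b [::]).
have IHk k : rapid d (ReF (pderiv k.1 k.2 f)) /\ rapid d (ImF (pderiv k.1 k.2 f)).
  apply: IH => // b s; have [K KP] := df b (rcons s k).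
  by exists K => U; rewrite -iter_pderiv_rcons.
by split; split=> // -[i j]; have [] := IHk (i, j).
Qed.

Lemma rapid_foldr s (u : X -> R) : (forall d, rapid d u) ->
  forall d, rapid d (foldr (@dpar R m n) u s).
Proof. by move=> ru; elim: s => //= k s IH d; have [_] := IH d.+1; apply. Qed.

Lemma rapid_schwartz f : Cinf (ReF f) -> Cinf (ImF f) ->
  (forall d, rapid d (ReF f)) -> (forall d, rapid d (ImF f)) -> schwartz f.
Proof.
move=> sr si rr ri; split; first exact: Cinf_smooth.
move=> b s.
have [K KP] := rapid_decaying (rapid_foldr s rr 0) b.
have [K' KP'] := rapid_decaying (rapid_foldr s ri 0) b.
exists (K + K') => U; apply: le_trans (normc_le_Re_Im _) _.
rewrite lecR Re_scale Im_scale lerD//.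
  by have := KP U; rewrite -ReF_iter_pderiv.
by have := KP' U; rewrite -ImF_iter_pderiv.
Qed.

End RealAndImaginaryParts.

(** * The exponential as a bijection onto the growth solutions *)

Section GrowthSolutions.
Variables (R : realType) (m n alpha : nat) (A : 'M[int]_m).
Local Notation X := 'M[R]_(m, n).
Local Notation C := R[i]%C.
Hypothesis Apd : symmetric_posdef R A.
Local Notation M := (real_mx R A).
Local Notation S := (invmx M).
Implicit Types (f g : X -> C) (u : X -> R) (U : X) (P : 'M[C]_(m, n) -> C).

Lemma real_mx_sym : M^T = M.
Proof.
apply/matrixP => i j; rewrite !mxE.
by have := congr1 (fun T : 'M[int]_m => T i j) Apd.1; rewrite mxE => ->.
Qed.

Local Notation Msym := real_mx_sym.
Local Notation Mpd := Apd.2.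

Lemma ReF_mul_gauss f : ReF (fun U => f U * (gauss A U)%:C%C) = ReF f * gs M (- pi).
Proof.
by apply/funext => U; rewrite /ReF mulrC Re_scale mulrC /gauss tr_qf.
Qed.

Lemma ImF_mul_gauss f : ImF (fun U => f U * (gauss A U)%:C%C) = ImF f * gs M (- pi).
Proof.
by apply/funext => U; rewrite /ImF mulrC Im_scale mulrC /gauss tr_qf.
Qed.

(** Multiplication by the inverse Gaussian [gs M pi], which is smooth as well. *)
Lemma Cinf_mul_gsK u : Cinf (u * gs M (- pi)) -> Cinf u.
Proof.
move=> su; have -> : u = (u * gs M (- pi)) * gs M pi.
  apply/funext => U; change (u U = u U * gs M (- pi) U * gs M pi U).
  by rewrite -mulrA /gs -expRD mulNr addNr expR0 mulr1.
by apply: CinfM => //; exact: Cinf_gs Msym _.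
Qed.

Lemma Re_euler f U i j : complex.Re (euler f U i j) = eu i j (ReF f) U.
Proof. by rewrite mxE Re_sum euE; apply: eq_bigr => d _; rewrite Re_scale. Qed.

Lemma Im_euler f U i j : complex.Im (euler f U i j) = eu i j (ImF f) U.
Proof. by rewrite mxE Im_sum euE; apply: eq_bigr => d _; rewrite Im_scale. Qed.

Lemma Re_laplace f U i j : complex.Re (laplace A f U i j) = lap S i j (ReF f) U.
Proof.
rewrite mxE Re_sum lapE; apply: eq_bigr => a _; rewrite Re_sum.
by apply: eq_bigr => b _; rewrite Re_scale.
Qed.

Lemma Im_laplace f U i j : complex.Im (laplace A f U i j) = lap S i j (ImF f) U.
Proof.
rewrite mxE Im_sum lapE; apply: eq_bigr => a _; rewrite Im_sum.
by apply: eq_bigr => b _; rewrite Im_scale.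
Qed.

Lemma ReF_iter_tr_laplace f k : ReF (iter k (tr_laplace A) f) = iter k (trl S) (ReF f).
Proof.
elim: k => //= k <-; apply/funext => U; rewrite /ReF /tr_laplace /mxtrace Re_sum trlE.
by apply: eq_bigr => i _; exact: Re_laplace.
Qed.

Lemma ImF_iter_tr_laplace f k : ImF (iter k (tr_laplace A) f) = iter k (trl S) (ImF f).
Proof.
elim: k => //= k <-; apply/funext => U; rewrite /ImF /tr_laplace /mxtrace Im_sum trlE.
by apply: eq_bigr => i _; exact: Im_laplace.
Qed.

(** The system for a real function with free Laplace coefficient: [q = 0] gives the pure Euler
    equations, [q = (4 * pi)^-1] the given system. *)
Definition eigen_pde (q : R) u : Prop := forall i j U,
  eu i j u U = alpha%:R * (i == j)%:R * u U + q * lap S i j u U.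

Lemma pde_solutionP f : pde_solution A alpha f <->
  eigen_pde (4 * pi)^-1 (ReF f) /\ eigen_pde (4 * pi)^-1 (ImF f).
Proof.
have ent (T1 T2 : 'M[C]_n) (c a : C) i j :
    (T1 - c *: T2 - a *: 1%:M) i j = T1 i j - c * T2 i j - a * (i == j)%:R.
  by rewrite !mxE.
have key (a b c : R) : a - b - c = 0 <-> a = c + b.
  split=> [/eqP|->]; last by ring.
  by rewrite subr_eq0 subr_eq => /eqP.
have ReN (z : C) : complex.Re (- z) = - complex.Re z by case: z.
have ImN (z : C) : complex.Im (- z) = - complex.Im z by case: z.
have eigE U (i j : 'I_n) : alpha%:R * f U * (i == j)%:R =
    (alpha%:R * (i == j)%:R : R)%:C%C * f U.
  by rewrite rmorphM !rmorph_nat mulrAC.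
have reE U i j : complex.Re ((euler f U - ((4 * pi)^-1)%:C%C *: laplace A f U -
    (alpha%:R * f U) *: 1%:M) i j) = eu i j (ReF f) U -
    (4 * pi)^-1 * lap S i j (ReF f) U - alpha%:R * (i == j)%:R * ReF f U.
  by rewrite ent !ReD !ReN eigE !Re_scale Re_euler Re_laplace.
have imE U i j : complex.Im ((euler f U - ((4 * pi)^-1)%:C%C *: laplace A f U -
    (alpha%:R * f U) *: 1%:M) i j) = eu i j (ImF f) U -
    (4 * pi)^-1 * lap S i j (ImF f) U - alpha%:R * (i == j)%:R * ImF f U.
  by rewrite ent !ImD !ImN eigE !Im_scale Im_euler Im_laplace.
split=> [fE|[rE iE] U].
  have f0 U i j : (euler f U - ((4 * pi)^-1)%:C%C *: laplace A f U -
      (alpha%:R * f U) *: 1%:M) i j = 0 by rewrite (fE U) subrr mxE.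
  split=> i j U; apply/key.
    by apply: etrans (esym (reE U i j)) _; rewrite f0.
  by apply: etrans (esym (imE U i j)) _; rewrite f0.
apply/eqP; rewrite -subr_eq0; apply/eqP/matrixP => i j; rewrite [RHS]mxE.
by apply: complex_ext; rewrite ?reE ?imE; apply/key; [exact: rE|exact: iE].
Qed.

Lemma eigen_solution_polyR u : eigen_pde (4 * pi)^-1 u -> Cinf u ->
  (forall d, rapid d (u * gs M (- pi))) -> polyR u.
Proof.
move=> ue su ru.
apply: (solution_polyR Msym Mpd (kappa := n%:R * alpha%:R)) => // U.
rewrite fct_sumE trlE (eq_bigr (fun i => alpha%:R * u U +
    (4 * pi)^-1 * lap S i i u U)); last first.
  by move=> i _; rewrite ue eqxx mulr1.
by rewrite big_split /= sumr_const card_ord mulr_sumr addrK -[_ *+ n]mulr_natl mulrA.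
Qed.

(** This trades the growth condition for polynomiality, so that the rest is algebra on polynomials.
    In the converse direction the Gaussian dominates every polynomial. *)
Lemma growth_solutionP f : growth_solution A alpha f <->
  [/\ cpolyR f, eigen_pde (4 * pi)^-1 (ReF f) & eigen_pde (4 * pi)^-1 (ImF f)].
Proof.
split=> [[/pde_solutionP[rE iE] sf]|[[rf cf] rE iE]].
  have := smooth_Cinf sf.1; rewrite ReF_mul_gauss ImF_mul_gauss => -[sr si].
  have rap d := schwartz_rapid sf d.
  split=> //; split; apply: eigen_solution_polyR => //.
  - exact: Cinf_mul_gsK.
  - by move=> d; have [+ _] := rap d; rewrite ReF_mul_gauss.
  - exact: Cinf_mul_gsK.
  - by move=> d; have [_ +] := rap d; rewrite ImF_mul_gauss.
split; first exact/pde_solutionP.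
have sg : Cinf (gs M (- pi) : X -> R) := Cinf_gs n Msym (- pi).
apply: rapid_schwartz; rewrite ?ReF_mul_gauss ?ImF_mul_gauss.
- by apply: CinfM => //; exact: polyR_Cinf.
- by apply: CinfM => //; exact: polyR_Cinf.
- by move=> d; exact: polyR_gs_rapid Msym Mpd _ _ rf.
- by move=> d; exact: polyR_gs_rapid Msym Mpd _ _ cf.
Qed.

(** Any sufficiently large [K] is allowed, so that several functions can share one truncation. *)
Lemma exp_tr_laplaceE c f K :
  iter K (trl S) (ReF f) = 0 -> iter K (trl S) (ImF f) = 0 ->
  ReF (exp_tr_laplace A c f) = texp S c K (ReF f) /\
  ImF (exp_tr_laplace A c f) = texp S c K (ImF f).
Proof.
move=> rK iK.
have E U : exp_tr_laplace A c f U =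
    \sum_(k < K) (c ^+ k / k`!%:R)%:C%C * iter k (tr_laplace A) f U.
  apply: limn_series_eventually0 => k Kk.
  have -> : iter k (tr_laplace A) f = 0; last by rewrite mulr0.
  apply: fun_complex_ext; rewrite ?ReF_iter_tr_laplace ?ImF_iter_tr_laplace.
    by rewrite (iter_trl_ge0 rK Kk).
  by rewrite (iter_trl_ge0 iK Kk).
split; apply/funext => U.
  rewrite /ReF E Re_sum /texp fct_sumE; apply: eq_bigr => k _.
  by rewrite Re_scale -/(ReF _ U) ReF_iter_tr_laplace.
rewrite /ImF E Im_sum /texp fct_sumE; apply: eq_bigr => k _.
by rewrite Im_scale -/(ImF _ U) ImF_iter_tr_laplace.
Qed.

Lemma cpolyR_nilp f : cpolyR f -> exists K,
  iter K (trl S) (ReF f) = 0 /\ iter K (trl S) (ImF f) = 0.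
Proof.
move=> [rf cf]; have [d rd] := polyR_degle rf; have [e ie] := polyR_degle cf.
exists (maxn d e); split.
  apply: (iter_trl_ge0 _ (leq_maxl d e)).
  exact: iter_trl_degle (polyR_Cinf rf) rd.
apply: (iter_trl_ge0 _ (leq_maxr d e)).
exact: iter_trl_degle (polyR_Cinf cf) ie.
Qed.

Lemma det_poly_eigen P : det_poly alpha P ->
  [/\ cpolyR (restr_real P), eigen_pde 0 (ReF (restr_real P)) &
      eigen_pde 0 (ImF (restr_real P))].
Proof.
move=> [pP PN]; have [rP iP] := restr_real_cpolyR pP.
have mapN (N : 'M[R]_n) U : restr_real P (U *m N) =
    (\det N ^+ alpha)%:C%C * restr_real P U.
  by rewrite /restr_real map_mxM PN det_map_mx rmorphXn.
split=> // i j U; rewrite mul0r addr0; apply: det_euler => // N V.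
  by rewrite /ReF mapN Re_scale.
by rewrite /ImF mapN Im_scale.
Qed.

Lemma eigen_det_poly f : cpolyR f -> eigen_pde 0 (ReF f) -> eigen_pde 0 (ImF f) ->
  exists2 P, det_poly alpha P & f = restr_real P.
Proof.
move=> pf rE iE; have [P pP fP] := cpolyR_real_poly_fun pf; exists P => //.
split=> // N U; apply/eqP; rewrite -subr_eq0; apply/eqP.
(* The entries of [U] and [N] form a single family of variables, so that both become complex in one
   application of [poly_real_ext]. *)
pose G (v : ('I_m * 'I_n) + ('I_n * 'I_n) -> C) :=
  P ((\matrix_(i, j) v (inl (i, j))) *m (\matrix_(i, j) v (inr (i, j)))) -
  \det (\matrix_(i < n, j < n) v (inr (i, j))) ^+ alpha *
    P (\matrix_(i, j) v (inl (i, j))).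
pose v0 k := match k with inl k => U k.1 k.2 | inr k => N k.1 k.2 end.
have -> : P (U *m N) - \det N ^+ alpha * P U = G v0.
  rewrite /G; have -> : (\matrix_(i, j) v0 (inl (i, j))) = U.
    by apply/matrixP => i j; rewrite mxE.
  by have -> : (\matrix_(i, j) v0 (inr (i, j))) = N
    by apply/matrixP => i j; rewrite mxE.
apply: poly_real_ext => [v k|x].
  have pU i j : polyin (fun t => (\matrix_(i < m, j < n) upd v k t (inl (i, j))) i j).
    by have [q qE] := polyin_upd v k (inl (i, j)); exists q => t; rewrite mxE.
  have pN i j : polyin (fun t => (\matrix_(i < n, j < n) upd v k t (inr (i, j))) i j).
    by have [q qE] := polyin_upd v k (inr (i, j)); exists q => t; rewrite mxE.
  rewrite /G; apply: polyinD.
    by apply: polyin_poly_fun => //; exact: polyin_mulmx.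
  under eq_fun do rewrite -mulN1r.
  apply: polyinM; first exact: polyin_cst.
  apply: polyinM; last exact: polyin_poly_fun.
  by apply: polyinX; exact: polyin_det.
pose xU : X := \matrix_(i, j) x (inl (i, j)).
pose xN : 'M[R]_n := \matrix_(i, j) x (inr (i, j)).
have UE : \matrix_(i, j) (x (inl (i, j)))%:C%C = map_mx (real_complex R) xU.
  by apply/matrixP => i j; rewrite !mxE.
have NE : \matrix_(i, j) (x (inr (i, j)))%:C%C = map_mx (real_complex R) xN.
  by apply/matrixP => i j; rewrite !mxE.
rewrite /G UE NE -map_mxM det_map_mx -rmorphXn.
rewrite -[P (map_mx _ xU)]/(restr_real P xU) -[P _]/(restr_real P (xU *m xN)) -fP.
have E0 (u : X -> R) : eigen_pde 0 u ->
    forall i j V, eu i j u V = alpha%:R * (i == j)%:R * u V.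
  by move=> uE i j V; rewrite uE mul0r addr0.
apply/eqP; rewrite subr_eq0; apply/eqP; apply: complex_ext.
  by rewrite Re_scale -!/(ReF f _); exact: euler_det pf.1 (E0 _ rE) _ _.
by rewrite Im_scale -!/(ImF f _); exact: euler_det pf.2 (E0 _ iE) _ _.
Qed.

Let c : R := - (8 * pi)^-1.

Lemma eigen_texp (q d : R) K u : Cinf u -> iter K (trl S) u = 0 ->
  eigen_pde q u -> eigen_pde (q - 2 * d) (texp S d K.+1 u).
Proof.
move=> su uK uE i j U.
have -> : eu i j (texp S d K.+1 u) = (alpha%:R * (i == j)%:R) *: texp S d K.+1 u +
    (q - 2 * d) *: lap S i j (texp S d K.+1 u); last by [].
apply: (eu_texp_eigen d (sym_invmx Msym) su uK).
by apply/funext => V; exact: uE.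
Qed.

Lemma double_c : 0 - 2 * c = (4 * pi)^-1.
Proof.
have key (p : R) : p != 0 -> 0 - 2 * - (8 * p)^-1 = (4 * p)^-1.
  by move=> p0; field.
by apply: key; exact: lt0r_neq0 (pi_gt0 R).
Qed.

Lemma double_Nc : (4 * pi)^-1 - 2 * - c = 0.
Proof. by rewrite -double_c; ring. Qed.

Lemma exp_det_poly_growth P : det_poly alpha P ->
  growth_solution A alpha (exp_tr_laplace A c (restr_real P)).
Proof.
move=> /det_poly_eigen [pf rE iE]; have [K [rK iK]] := cpolyR_nilp pf.
have [reE imE] := exp_tr_laplaceE c (iter_trl_ge0 rK (leqnSn K))
  (iter_trl_ge0 iK (leqnSn K)).
apply/growth_solutionP; rewrite /cpolyR reE imE -double_c; split.
- by split; apply: polyR_texp; [exact: pf.1|exact: pf.2].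
- exact: eigen_texp (polyR_Cinf pf.1) rK rE.
- exact: eigen_texp (polyR_Cinf pf.2) iK iE.
Qed.

Lemma iter_trl_texp d K L u : Cinf u -> iter K (trl S) u = 0 ->
  iter K (trl S) (texp S d L u) = 0.
Proof.
move=> su uK; have linK := smlin_iter K (@smlin_trl R m n S).
have si k : Cinf (iter k (trl S) u).
  exact: (smlin_iter k (@smlin_trl R m n S)).1 _ su.
rewrite (smlin_sum linK); last by move=> k; exact: CinfZ.
apply: big1 => k _; rewrite (smlinZ linK)// -iterD addnC iterD uK.
by rewrite (smlin0 (smlin_iter k (@smlin_trl R m n S))) scaler0.
Qed.

Lemma growth_exp_det_poly f : growth_solution A alpha f ->
  exists2 P, det_poly alpha P & f = exp_tr_laplace A c (restr_real P).
Proof.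
move=> /growth_solutionP [pf rE iE]; have [K [rK iK]] := cpolyR_nilp pf.
(* The preimage is obtained with the inverse exponential, part by part. *)
pose g U : C := (texp S (- c) K.+1 (ReF f) U +i* texp S (- c) K.+1 (ImF f) U)%C.
have [sr si] := (polyR_Cinf pf.1, polyR_Cinf pf.2).
have [rK1 iK1] := (iter_trl_ge0 rK (leqnSn K), iter_trl_ge0 iK (leqnSn K)).
have [|||P dP gP] := @eigen_det_poly g.
- by split; apply: polyR_texp; [exact: pf.1|exact: pf.2].
- by rewrite -double_Nc; exact: eigen_texp sr rK rE.
- by rewrite -double_Nc; exact: eigen_texp si iK iE.
exists P => //; rewrite -gP.
have [reE imE] := @exp_tr_laplaceE c g K.+1 (iter_trl_texp _ _ sr rK1)
  (iter_trl_texp _ _ si iK1).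
apply: fun_complex_ext.
  by rewrite reE [ReF g]/(texp S (- c) K.+1 (ReF f)) texpK.
by rewrite imE [ImF g]/(texp S (- c) K.+1 (ImF f)) texpK.
Qed.

Lemma ReF_lin (a : C) f g :
  ReF (a *: f + g) = complex.Re a *: ReF f + ((- complex.Im a) *: ImF f + ReF g).
Proof.
apply/funext => U; rewrite /ReF -[(a *: f + g) U]/(a * f U + g U) ReD ReM.
by rewrite -addrA -mulNr.
Qed.

Lemma ImF_lin (a : C) f g :
  ImF (a *: f + g) = complex.Re a *: ImF f + (complex.Im a *: ReF f + ImF g).
Proof.
apply/funext => U; rewrite /ImF -[(a *: f + g) U]/(a * f U + g U) ImD ImM.
by rewrite -addrA.
Qed.

Lemma cpolyR_lin (a : C) f g : cpolyR f -> cpolyR g -> cpolyR (a *: f + g).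
Proof. by move=> pf pg; apply: cpolyRD pg; apply: cpolyRM pf; exact: cpolyR_cst. Qed.

(** Polynomiality turns the limits into finite sums. A complex scalar mixes real and imaginary
    parts, and [texp] respects this since it is the same real operator on both. *)
Lemma exp_tr_laplace_lin (d : R) (a : C) f g : cpolyR f -> cpolyR g ->
  exp_tr_laplace A d (a *: f + g) =
  a *: exp_tr_laplace A d f + exp_tr_laplace A d g.
Proof.
move=> pf pg; have [K1 [rf fi]] := cpolyR_nilp pf.
have [K2 [rg gi]] := cpolyR_nilp pg.
have [K3 [rh hi]] := cpolyR_nilp (cpolyR_lin a pf pg).
pose K := maxn K1 (maxn K2 K3).
have le1 : (K1 <= K)%N := leq_maxl _ _.
have le2 : (K2 <= K)%N by rewrite leq_max (leq_maxl K2) orbT.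
have le3 : (K3 <= K)%N by rewrite leq_max (leq_maxr K2) orbT.
have [rfE ifE] := exp_tr_laplaceE d (iter_trl_ge0 rf le1) (iter_trl_ge0 fi le1).
have [rgE igE] := exp_tr_laplaceE d (iter_trl_ge0 rg le2) (iter_trl_ge0 gi le2).
have [rhE ihE] := exp_tr_laplaceE d (iter_trl_ge0 rh le3) (iter_trl_ge0 hi le3).
have linT := @smlin_texp R m n S d K.
have [srf sif] := (polyR_Cinf pf.1, polyR_Cinf pf.2).
have [srg sig] := (polyR_Cinf pg.1, polyR_Cinf pg.2).
have lin2 (x y : R) (u v w : X -> R) : Cinf u -> Cinf v -> Cinf w ->
    texp S d K (x *: u + (y *: v + w)) =
    x *: texp S d K u + (y *: texp S d K v + texp S d K w).
  move=> su sv sw; rewrite (linT.2 x u (y *: v + w) su); last exact/CinfD/sw/CinfZ.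
  by rewrite (linT.2 y v w sv sw).
apply: fun_complex_ext.
  by rewrite rhE !ReF_lin rfE ifE rgE lin2.
by rewrite ihE !ImF_lin rfE ifE igE lin2.
Qed.

Lemma exp_tr_laplace_inj f : cpolyR f -> exp_tr_laplace A c f = 0 -> f = 0.
Proof.
move=> pf e0; have [K [rK iK]] := cpolyR_nilp pf.
have [rE iE] := exp_tr_laplaceE c rK iK.
have [sr si] := (polyR_Cinf pf.1, polyR_Cinf pf.2).
apply: fun_complex_ext.
  rewrite -[LHS](texpK (- c) sr rK) opprK -rE e0.
  exact: smlin0 (@smlin_texp R m n S _ K).
rewrite -[LHS](texpK (- c) si iK) opprK -iE e0.
exact: smlin0 (@smlin_texp R m n S _ K).
Qed.

Lemma exp_tr_laplace_sum r (B : 'I_r -> X -> C) (a : 'I_r -> C) :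
  (forall i, cpolyR (B i)) ->
  exp_tr_laplace A c (\sum_(i < r) a i *: B i) =
  \sum_(i < r) a i *: exp_tr_laplace A c (B i).
Proof.
move=> pB.
(* Polynomiality of the partial sums is carried through the induction, as [exp_tr_laplace_lin] needs
   it. *)
suff [] : cpolyR (\sum_(i < r) a i *: B i) /\
    exp_tr_laplace A c (\sum_(i < r) a i *: B i) =
    \sum_(i < r) a i *: exp_tr_laplace A c (B i) by [].
elim: (index_enum _) => [|i s [ps IH]]; last first.
  by rewrite !big_cons exp_tr_laplace_lin// IH; split=> //; exact: cpolyR_lin.
rewrite !big_nil; split; first exact: cpolyR_cst.
have [r0 i0] : ReF (0 : X -> C) = 0 /\ ImF (0 : X -> C) = 0.
  by split; apply/funext.
have [rE iE] := @exp_tr_laplaceE c (0 : X -> C) 0 r0 i0.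
by apply: fun_complex_ext; rewrite ?rE ?iE /texp big_ord0.
Qed.

End GrowthSolutions.

Theorem proposition3p8 (R : realType) (m n alpha : nat) (A : 'M[int]_m)
    (r : nat) (B : 'I_r -> 'M[R[i]%C]_(m, n) -> R[i]%C) :
  symmetric_posdef R A ->
  is_basis (@det_poly R m n alpha) B ->
  (forall f : 'M[R]_(m, n) -> R[i]%C,
      growth_solution A alpha f -> real_poly_fun f) /\
  is_basis (@growth_solution R m n A alpha)
    (fun i => exp_tr_laplace A (- (8 * pi)^-1)%R (restr_real (B i))).
Proof.
move=> Apd [freeB spanB]; split=> [f /(growth_solutionP alpha Apd)[pf _ _]|].
  exact: cpolyR_real_poly_fun.
have dP c : det_poly alpha (\sum_(i < r) c i *: B i).
  by rewrite -spanB; exists c.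
have dB i : det_poly alpha (B i).
  have -> : B i = \sum_(j < r) (i == j)%:R *: B j.
    rewrite (bigD1 i)//= eqxx scale1r big1 ?addr0// => j.
    by rewrite eq_sym => /negbTE ->; rewrite scale0r.
  exact: dP.
have restrE (c : 'I_r -> R[i]%C) : restr_real (\sum_(i < r) c i *: B i) =
    \sum_(i < r) c i *: restr_real (B i).
  exact: (big_morph (@restr_real R m n) (op1 := +%R) (id1 := 0)).
have expE (c : 'I_r -> R[i]%C) :
    exp_tr_laplace A (- (8 * pi)^-1) (restr_real (\sum_(i < r) c i *: B i)) =
    \sum_(i < r) c i *: exp_tr_laplace A (- (8 * pi)^-1) (restr_real (B i)).
  rewrite restrE exp_tr_laplace_sum// => i.
  exact: restr_real_cpolyR (dB i).1.
split.
  (* A vanishing combination is pulled back twice: through the exponential on real polynomials, then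
     through restriction to real matrices. *)
  move=> c; rewrite -expE => e0; apply: freeB.
  have [pP _] := dP c.
  have p0 : poly_fun (0 : 'M[R[i]%C]_(m, n) -> R[i]%C) by exact: poly_fun_cst.
  apply: (restr_real_inj pP p0).
  exact: exp_tr_laplace_inj (restr_real_cpolyR pP) e0.
apply/seteqP; split=> [f [c ->]|f].
  by rewrite -expE; exact: exp_det_poly_growth.
move=> /(growth_exp_det_poly Apd) [P + ->].
by rewrite -spanB => -[c ->]; exists c.
Qed.
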